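(* Let $\Omega$ be a set, $\mathscr{A}\subset 2^{\Omega}$ an algebra and $\mu\in ba(\mathscr{A})$. Every positive linear functional $\phi$ on $L(\mu)$ admits a positive representing measure $m$ such that $\lim_n m(h_n)=0$ for every sequence $\langle h_n\rangle_{n\in\mathbb{N}}$ in $L(\mu)$ which converges to $0$ orderly in $L(\mu)$.
   Context: Spaces of real-valued functions on $\Omega$ carry the pointwise order. For an algebra $\mathscr{A}\subset 2^\Omega$, $ba(\mathscr{A})$ is the space of bounded finitely additive (signed) real set functions on $\mathscr{A}$; $ba=ba(2^\Omega)$ and $ba_+$ is its set of nonnegative elements. For $\mu\in ba(\mathscr{A})$, $L(\mu)$ is the space of real-valued functions $f$ on $\Omega$ integrable with respect to $\mu$ in the finitely additive (Dunford–Schwartz) sense: there are $\mathscr{A}$-simple functions $s_n$ converging to $f$ in $|\mu|$-measure (using the outer set function $|\mu|^*(E)=\inf\{|\mu|(A):A\in\mathscr{A},E\subset A\}$) with $\int|s_n-s_k|\,d|\mu|\to0$ as $n,k\to\infty$; $\mu(f)=\lim_n\int s_n\,d\mu$ is the integral, and $L(\mu)$ has the (semi)norm $\|f\|=\int|f|\,d|\mu|$. When $m\in ba_+$ and $f\geq 0$, $f\in L(m)$ iff $\sup\{m(h):h\text{ bounded},0\leq h\leq f\}<\infty$, and then $m(f)$ equals this supremum. Order convergence: a sequence $\langle f_n\rangle$ converges orderly in $L(\mu)$ to $f\in\mathbb{R}^\Omega$ if $f_n\in L(\mu)$ for all $n$ and there is a pointwise decreasing sequence $\langle\bar f_n\rangle$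 of nonnegative elements of $L(\mu)$ which converges to $0$ in the norm of $L(\mu)$ and satisfies $|f_n-f|\leq\bar f_n$ for all $n\geq1$. Representing measure: for a linear functional $\phi$ on a linear subspace $\mathscr{L}\subset\mathbb{R}^\Omega$ with $1\in\mathscr{L}$, a representing measure for $\phi$ is an $m\in ba$ such that $\mathscr{L}\subset L(m)$ and $\phi(f)=\phi(1)m(f)$ for all $f\in\mathscr{L}$; it is positive if $m\in ba_+$. Here $\mathscr{L}=L(\mu)$.
   Formalization: The formal theorem also assumes that φ takes equal values on f, g in L(μ) with ‖f−g‖=0; without this the claim fails (μ=0, φ(f)=f(ω₀), hₙ=1), and the conclusion forces this condition. *)

(* Defs.v *)
(* MathComp-Analysis, over an arbitrary R : realType. *)
From HB Require Import structures.
From mathcomp Require Import all_boot all_order all_algebra.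
From mathcomp Require Import all_classical all_reals all_analysis.

Set Implicit Arguments.
Unset Strict Implicit.
Unset Printing Implicit Defensive.

Import Order.TTheory GRing.Theory Num.Theory.
Import numFieldNormedType.Exports.

Local Open Scope classical_set_scope.
Local Open Scope ring_scope.

(* A set function on an algebra G is a total function set Omega -> R of which
   only the values on G matter; a functional on a space L of functions is
   likewise a total function of which only the values on L matter. *)

Section FinitelyAdditive.
Context {R : realType} {Omega : Type}.
Implicit Types (G : set (set Omega)) (mu m : set Omega -> R).
Implicit Types (f g : Omega -> R) (L : set (Omega -> R)).
Implicit Types (phi : (Omega -> R) -> R).

Definition is_algebra G := [/\ G set0, setU_closed G & setC_closed G].

Definition ba G mu :=
  (forall E F, G E -> G F -> E `&` F = set0 -> mu (E `|` F) = mu E + mu F) /\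
  (exists M : R, forall E, G E -> `|mu E| <= M).

Definition tvar G mu (E : set Omega) : R :=
  sup [set x | exists (n : nat) (P : 'I_n -> set Omega),
    [/\ forall i, G (P i) /\ P i `<=` E,
        trivIset setT P &
        x = \sum_(i < n) `|mu (P i)|]].

Definition outer G mu (E : set Omega) : R :=
  inf [set mu F | F in [set F | G F /\ E `<=` F]].

Definition simple G f :=
  finite_set (range f) /\ forall x : R, G (f @^-1` [set x]).

Definition simple_int mu f : R :=
  \sum_(x \in range f) x * mu (f @^-1` [set x]).

Definition cvg_in_measure G mu (s : nat -> Omega -> R) f :=
  forall e : R, 0 < e ->
    outer G (tvar G mu) [set w | e < `|s n w - f w|] @[n --> \oo] --> (0 : R).

Definition determining G mu (s : nat -> Omega -> R) f :=
  [/\ forall n, simple G (s n),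
      cvg_in_measure G mu s f &
      simple_int (tvar G mu) (fun w => `|s p.1 w - s p.2 w|)
        @[p --> (\oo, \oo)] --> (0 : R)].

Definition L_ba G mu : set (Omega -> R) :=
  [set f | exists s, determining G mu s f].

Definition is_integral G mu f (x : R) :=
  exists2 s, determining G mu s f & simple_int mu (s n) @[n --> \oo] --> x.

(* For mu in ba(G) and f in L(mu) the limit exists and does not depend on the
   determining sequence; 0 is only a default value outside L(mu). *)
Definition integral_ba G mu f : R := xget 0 [set x | is_integral G mu f x].

Definition Lnorm_ba G mu f : R :=
  integral_ba G (tvar G mu) (fun w => `|f w|).

Definition order_cvg G mu (h : nat -> Omega -> R) f :=
  (forall n, L_ba G mu (h n)) /\
  exists hbar : nat -> Omega -> R,
    [/\ forall n, L_ba G mu (hbar n),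
        forall n w, 0 <= hbar n w,
        forall n w, hbar n.+1 w <= hbar n w,
        Lnorm_ba G mu (hbar n) @[n --> \oo] --> (0 : R) &
        forall n w, `|h n w - f w| <= hbar n w].

Definition linear_on L phi :=
  forall (a : R) f g, L f -> L g ->
    phi (fun w => a * f w + g w) = a * phi f + phi g.

Definition positive_on L phi :=
  forall f, L f -> (forall w, 0 <= f w) -> 0 <= phi f.

(* The usual Dunford-Schwartz convention for the normed space L(mu): functions
   at distance 0 are the same element, so a functional on L(mu) takes the same
   value on them.  Without this, mu = 0 (for which L(mu) is the set of all
   functions, each of seminorm 0) and phi f = f w0 give a positive functional
   with phi 1 = 1, while the constant sequence 1 converges to 0 orderly. *)
Definition respects_null G mu phi :=
  forall f g, L_ba G mu f -> L_ba G mu g ->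
    Lnorm_ba G mu (fun w => f w - g w) = 0 -> phi f = phi g.

Definition representing_measure L phi m :=
  [/\ ba [set: set Omega] m,
      L `<=` L_ba [set: set Omega] m &
      forall f, L f ->
        phi f = phi (fun=> 1) * integral_ba [set: set Omega] m f].

Definition positive_representing_measure L phi m :=
  representing_measure L phi m /\ forall E : set Omega, 0 <= m E.

End FinitelyAdditive.

(* Main.v *)
(* Write L for L(mu).  A positive functional phi on L is order continuous even though
   L need not be complete: if c_n decreases, vanishes eventually at every point, has
   integrals tending to 0 and is supported off small sets, then along a subsequence
   with summable integrals the pointwise finite sum g of the c_(n_k) belongs to L, and
   K phi(c_n) <= phi(g) for n large.  This applies to c_n = (|f| - n)^+, and to
   c_n = (fbar_n - h - e)^+, where fbar_n decreases to 0 in norm and h = inf fbar_n is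
   a null function.  By Hahn-Banach, phi / phi(1) extends to a positive functional l on
   all functions dominated by L; put m(E) = l(1_E).  A function f in L is within
   1/n + (|f| - n)^+ of a simple function s_n, so m(s_n) = l(s_n) tends to
   phi(f) / phi(1), and f is m-integrable.  If phi(1) = 0, then phi = 0 because
   |phi(f)| <= n phi(1) + phi((|f| - n)^+), and the convention 0^-1 = 0 makes the same
   formula give m = 0. *)
Require Import Defs.
From mathcomp Require Import all_boot all_order all_algebra finmap.
From mathcomp Require Import all_classical all_reals all_analysis.
From mathcomp Require Import lra ring.
Import numFieldNormedType.Exports.

Set Implicit Arguments.
Unset Strict Implicit.
Unset Printing Implicit Defensive.

Import Order.TTheory GRing.Theory Num.Theory.

Local Open Scope classical_set_scope.
Local Open Scope ring_scope.

(** * Algebras and finitely additive charges *)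

(** The obstacle is that an absolutely convergent series in [L] may have no sum in [L], so the
    standard proof that a positive functional is norm continuous does not apply. That argument
    survives when the sum is a function given in advance to which the partial sums converge in
    measure; hence the demand that the summands vanish eventually at every point and off sets of
    small charge. A norm-null decreasing sequence need not vanish anywhere, but it converges
    pointwise to its infimum [h], so subtracting [h] and a constant [e] forces vanishing. The
    constant costs [e * phi 1], and [h] costs nothing because [phi] respects null functions. Bounded
    functions, and so the indicators of all subsets, are dominated by constants; this is why an
    extension to dominated functions already yields a charge on the power set. On [L] the integral
    of [m] is a fixed multiple of [phi], so the order limit becomes a statement about [phi]
    alone. *)

Section Algebra.
Context {Omega : Type} (G : set (set Omega)) (hG : is_algebra G).

Lemma algebraT : G setT.
Proof. by case: hG => G0 _ GC; rewrite -setC0; exact: GC. Qed.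

Lemma algebraI E F : G E -> G F -> G (E `&` F).
Proof.
case: hG => _ GU GC GE GF; rewrite -[E `&` F]setCK setCI.
by apply: (GC); apply: GU; apply: (GC).
Qed.

Lemma algebraD E F : G E -> G F -> G (E `\` F).
Proof. by case: hG => _ _ GC GE GF; rewrite setDE; apply: algebraI => //; exact: GC. Qed.

Lemma algebra_bigsetU (I : Type) (r : seq I) (P : pred I) (F : I -> set Omega) :
  (forall i, P i -> G (F i)) -> G (\big[setU/set0]_(i <- r | P i) F i).
Proof. by case: hG => G0 GU _ GF; elim/big_ind: _. Qed.

(* At codomain [R] this is convertible to [simple]. *)
Definition gsimple {T : Type} (h : Omega -> T) :=
  finite_set (range h) /\ forall t, G (h @^-1` [set t]).

Lemma gsimple_preimage {T : Type} (h : Omega -> T) (B : set T) :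
  gsimple h -> G (h @^-1` B).
Proof.
case: hG => G0 GU _ [hfin hlev].
rewrite (_ : h @^-1` B = \bigcup_(t in range h `&` B) h @^-1` [set t]).
  have /fin_bigcup_closedP GUf : G set0 /\ setU_closed G by [].
  by apply: GUf => [|t _ //]; exact: finite_setIl.
apply/seteqP; split => [w Bw|w [t [_ Bt] /= ->] //].
by exists (h w) => //; split => //; exists w.
Qed.

Lemma gsimple_comp {T U : Type} (h : Omega -> T) (F : T -> U) :
  gsimple h -> gsimple (fun w => F (h w)).
Proof.
move=> hs; split; last by move=> u; exact: (gsimple_preimage (F @^-1` [set u]) hs).
case: hs => hfin _; apply: sub_finite_set (finite_image F hfin).
by move=> _ [w _ <-]; exists (h w) => //; exists w.
Qed.

(** The joint level sets form the common refinement of two partitions; through it, two integrals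
    become sums over the same index set. *)
Lemma gsimple_pair {T U : Type} (h : Omega -> T) (k : Omega -> U) :
  gsimple h -> gsimple k -> gsimple (fun w => (h w, k w)).
Proof.
move=> [hf hG'] [kf kG]; split.
  apply: sub_finite_set (finite_setX hf kf).
  by move=> _ [w _ <-]; split; exists w.
move=> [t u]; rewrite (_ : _ @^-1` _ = h @^-1` [set t] `&` k @^-1` [set u]).
  exact: algebraI.
by apply/seteqP; split => w /=; [case=> -> ->|case=> -> ->].
Qed.

End Algebra.

Section Charge.
Context {R : realType} {Omega : Type}.
Implicit Types (G : set (set Omega)) (v : set Omega -> R) (f g s : Omega -> R).

Definition additive_on G v :=
  forall E F, G E -> G F -> E `&` F = set0 -> v (E `|` F) = v E + v F.

Definition pos_charge G v := (forall E, G E -> 0 <= v E) /\ additive_on G v.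

Lemma additive_set0 G v : is_algebra G -> additive_on G v -> v set0 = 0.
Proof.
move=> [G0 _ _] vU; have := vU _ _ G0 G0 (set0I _); rewrite setU0.
by move/eqP; rewrite eq_sym addrC -subr_eq0 addrK => /eqP.
Qed.

Lemma additive_bigsetU G v (I : eqType) (r : seq I) (P : pred I)
    (F : I -> set Omega) : is_algebra G -> additive_on G v ->
  uniq r -> (forall i, P i -> G (F i)) -> trivIset [set` P] F ->
  v (\big[setU/set0]_(i <- r | P i) F i) = \sum_(i <- r | P i) v (F i).
Proof.
move=> hG vU + GF tF; elim: r => [|i r IH] /=.
  by rewrite !big_nil (additive_set0 hG vU).
move=> /andP[ir ur]; rewrite !big_cons; case: ifPn => Pi; last exact: IH.
rewrite vU ?IH //; [exact: GF|exact: algebra_bigsetU|].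
rewrite big_distrr /= big_seq_cond big1 // => j /andP[jr Pj].
have [/eqP Fij|] := pselect (F i `&` F j == set0) => // /negP/set0P Fij.
by move: ir; rewrite (tF i j Pi Pj Fij) jr.
Qed.

Context G v (hG : is_algebra G) (hv : pos_charge G v).

Lemma charge_subset E F : G E -> G F -> E `<=` F -> v E <= v F.
Proof.
move=> GE GF EF; have [v0 vU] := hv.
rewrite -(setDUK EF) vU ?lerDl ?v0 //; [exact: algebraD..|].
by rewrite setDE setICA setICr setI0.
Qed.

Lemma charge_setU_le E F : G E -> G F -> v (E `|` F) <= v E + v F.
Proof.
move=> GE GF; have [v0 vU] := hv.
have GFE : G (F `\` E) by exact: algebraD.
have -> : E `|` F = E `|` (F `\` E).
  by apply/seteqP; split => w /=; [move=> [|]; have [] := pselect (E w); tauto|tauto].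
rewrite vU // ?lerD2l; last by rewrite setDE setICA setICr setI0.
by apply: charge_subset => //; exact: subDsetl.
Qed.

End Charge.

(** * The integral of simple functions *)

Section SimpleIntegral.
Context {R : realType} {Omega : Type} (G : set (set Omega)) (v : set Omega -> R).
Implicit Types (f g s : Omega -> R).
Context (hG : is_algebra G) (hv : pos_charge G v).

Local Notation I := (simple_int v).
Local Notation simple := (simple G).

(** Grouping the fibres of [h] by the value of [F] and using additivity, the integral can be
    computed on any partition finer than the level sets. *)
Lemma simple_int_comp {T : choiceType} (h : Omega -> T) (F : T -> R) :
  gsimple G h -> I (fun w => F (h w)) =
    \sum_(t <- fset_set (range h)) F t * v (h @^-1` [set t]).
Proof.
move=> hs; have [hfin hlev] := hs.
rewrite /simple_int.
have -> : range (fun w => F (h w)) = F @` range h by rewrite image_comp.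
rewrite fsbig_finite; last exact: finite_image.
rewrite fset_set_image // [RHS](partition_big_imfset _ F) /=.
apply: eq_bigr => x _.
rewrite (_ : _ @^-1` _ =
    \big[setU/set0]_(t <- fset_set (range h) | F t == x) h @^-1` [set t]).
  rewrite (additive_bigsetU hG (proj2 hv)) ?fset_uniq // ?mulr_sumr; first last.
  - by move=> s t _ _ [w [/= -> ->]].
  by apply: eq_bigr => t /eqP ->.
rewrite -bigcup_seq_cond; apply/seteqP; split=> w /=.
  move=> Fw; exists (h w) => //=; rewrite Fw eqxx andbT.
  by rewrite in_fset_set // inE; exists w.
by move=> [t /= /andP[_ /eqP <-] ->].
Qed.

Lemma simple_cst (c : R) : simple (fun=> c).
Proof.
have [G0 _ _] := hG; split.
  by apply: sub_finite_set (finite_set1 c) => _ [w _ <-].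
move=> x; have [<-|cx] := pselect (c = x).
  by rewrite (_ : _ @^-1` _ = setT); [exact: algebraT|apply/seteqP; split].
by rewrite (_ : _ @^-1` _ = set0) //; apply/seteqP; split.
Qed.

Lemma simple_map2 f g (F : R -> R -> R) :
  simple f -> simple g -> simple (fun w => F (f w) (g w)).
Proof.
move=> sf sg.
exact: (gsimple_comp hG (fun p => F p.1 p.2) (gsimple_pair hG sf sg)).
Qed.

Lemma simple_map f (F : R -> R) : simple f -> simple (fun w => F (f w)).
Proof. exact: (gsimple_comp hG). Qed.

Lemma simple_level f (P : set R) : simple f -> G (f @^-1` P).
Proof. exact: (gsimple_preimage hG). Qed.

Lemma simple_indic E : G E -> simple (\1_E : Omega -> R).
Proof.
have [G0 _ GC] := hG; move=> GE.
suff bs : gsimple G (fun w => w \in E) by exact: (gsimple_comp hG (fun b : bool => b%:R : R) bs).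
split; first exact: finite_finset.
case; [rewrite (_ : _ @^-1` _ = E) //|rewrite (_ : _ @^-1` _ = ~` E)].
- by apply/seteqP; split => w /=; [move/set_mem|move/mem_set].
- exact: GC.
- by apply/seteqP; split => w /=; [move=> Ew /mem_set; rewrite Ew|exact: memNset].
Qed.

Lemma simple_norm_bounded f : simple f -> exists M, forall w, `|f w| <= M.
Proof.
move=> [ffin _].
exists (\sum_(x <- fset_set (range f)) `|x|) => w.
rewrite (big_rem (f w)) /= ?lerDl ?sumr_ge0 //.
by rewrite in_fset_set // inE; exists w.
Qed.

Lemma simple_int_linear a f g : simple f -> simple g ->
  I (fun w => a * f w + g w) = a * I f + I g.
Proof.
move=> sf sg; have fgs := gsimple_pair hG sf sg.
rewrite (simple_int_comp (fun p => a * p.1 + p.2) fgs).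
rewrite (simple_int_comp fst fgs) (simple_int_comp snd fgs).
rewrite mulr_sumr -big_split /=; apply: eq_bigr => p _.
by rewrite mulrDl mulrA.
Qed.

Lemma simple_int_ge0 f : simple f -> (forall w, 0 <= f w) -> 0 <= I f.
Proof.
move=> sf f0; rewrite (simple_int_comp id sf) big_seq sumr_ge0 // => x.
rewrite in_fset_set ?inE; last by case: sf.
by move=> [w _ <-]; rewrite mulr_ge0 // (proj1 hv) //; case: sf.
Qed.

Lemma simple_int_le f g : simple f -> simple g -> (forall w, f w <= g w) ->
  I f <= I g.
Proof.
move=> sf sg fg; rewrite -subr_ge0 addrC -mulN1r -simple_int_linear //.
apply: simple_int_ge0 => [|w]; last by rewrite mulN1r addrC subr_ge0.
exact: (simple_map2 (fun x y => -1 * x + y)).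
Qed.

Lemma simple_int_indic E : G E -> I (\1_E) = v E.
Proof.
move=> GE; rewrite /simple_int.
have E1 : \1_E @^-1` [set 1 : R] = E.
  apply/seteqP; split => w; rewrite /= indicE; last by move=> Ew; rewrite mem_set.
  by case: (boolP (w \in E)) => [/set_mem//|_ /eqP]; rewrite eq_sym oner_eq0.
have v0 x : ~ range (\1_E : Omega -> R) x -> x * v (\1_E @^-1` [set x]) = 0.
  move=> nx; suff -> : \1_E @^-1` [set x] = set0 by rewrite (additive_set0 hG (proj2 hv)) mulr0.
  by apply/seteqP; split => // w /= wx; apply: nx; exists w.
(* The range may miss 0 or 1, so the sums over the range and over [[set 1]] are both compared with
   the sum over all reals, where the extra terms vanish. *)
rewrite (fsbig_widen _ setT) //; last by move=> x [_ /v0].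
transitivity (\sum_(x \in [set (1 : R)]) x * v (\1_E @^-1` [set x])).
  apply/esym/fsbig_widen => // x [_ /= nx1].
  have [->|/eqP x0] := eqVneq x 0; first by rewrite mul0r.
  by apply: v0 => -[w _]; rewrite indicE; case: (_ \in _) => /esym.
by rewrite fsbig_set1 E1 mul1r.
Qed.

Lemma simple_int_cst c : I (fun=> c) = c * v setT.
Proof.
have GT := algebraT hG; have s1 := simple_indic GT.
have -> : (fun=> c) = fun w : Omega => (c - 1) * \1_setT w + \1_setT w.
  by apply/funext => w; rewrite indicT /cst mulr1 subrK.
by rewrite simple_int_linear // simple_int_indic // -[X in _ + X]mul1r -mulrDl subrK.
Qed.

End SimpleIntegral.

(** * Approximation in measure *)

Section Closeness.
Context {R : realType} {Omega : Type} (G : set (set Omega)) (v : set Omega -> R).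
Implicit Types (f g : Omega -> R).

(* One parameter bounds both the exceptional set and the error off it, so that
   convergence in measure can be stated without the outer measure. *)
Definition close (e : R) f g :=
  exists F, [/\ G F, v F <= e & forall w, ~ F w -> `|f w - g w| <= e].

Context (hG : is_algebra G) (hv : pos_charge G v).

Lemma close_refl e f : 0 <= e -> close e f f.
Proof.
move=> e0; exists set0; split; first by case: hG.
  by rewrite (additive_set0 hG (proj2 hv)).
by move=> w _; rewrite subrr normr0.
Qed.

(** The union of the two exceptional sets costs [2 * d] and the error off it [(|a| + 1) * d]; the
    constant covers both. *)
Lemma close_linear a d f f' g g' : 0 <= d -> close d f f' -> close d g g' ->
  close ((`|a| + 2) * d) (fun w => a * f w + g w) (fun w => a * f' w + g' w).
Proof.
move=> d0 [F [GF vF ff]] [E [GE vE gg]].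
have [_ GU _] := hG; exists (F `|` E); split; first exact: GU.
  apply: le_trans (charge_setU_le hG hv GF GE) _.
  have : 0 <= `|a| * d by rewrite mulr_ge0.
  by lra.
move=> w nFE; have /ff ffw : ~ F w by move=> Fw; apply: nFE; left.
have /gg ggw : ~ E w by move=> Ew; apply: nFE; right.
rewrite (_ : _ - _ = a * (f w - f' w) + (g w - g' w)); last by ring.
apply: le_trans (ler_normD _ _) _; rewrite normrM.
have : `|a| * `|f w - f' w| <= `|a| * d by rewrite ler_wpM2l.
by lra.
Qed.

Lemma close_trans d e f g h : close d f g -> close e g h -> close (d + e) f h.
Proof.
move=> [F [GF vF fg]] [E [GE vE gh]].
have [_ GU _] := hG; exists (F `|` E); split; first exact: GU.
  by apply: le_trans (charge_setU_le hG hv GF GE) _; exact: lerD.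
move=> w nFE; rewrite (_ : _ - _ = (f w - g w) + (g w - h w)); last by ring.
apply: le_trans (ler_normD _ _) _; apply: lerD.
  by apply: fg => Fw; apply: nFE; left.
by apply: gh => Ew; apply: nFE; right.
Qed.

Lemma close_norm e f g : close e f g -> close e (fun w => `|f w|) (fun w => `|g w|).
Proof.
move=> [F [GF vF fg]]; exists F; split => // w /fg.
exact: le_trans (ler_dist_dist _ _).
Qed.

End Closeness.

Section Integral.
Context {R : realType} {Omega : Type} (G : set (set Omega)) (v : set Omega -> R).
Implicit Types (f g : Omega -> R) (s t : nat -> Omega -> R).
Local Notation I := (simple_int v).
Local Notation simple := (simple G).
Local Notation close := (close G v).

(** The epsilon form of [determining] for a positive charge, free of outer measures and double
    limits; [determiningE] gives the equivalence. *)
Definition approximates s f :=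
  [/\ forall n, simple (s n),
      forall e : R, 0 < e -> \forall n \near \oo, close e (s n) f &
      forall e : R, 0 < e -> exists N, forall n k, (N <= n)%N -> (N <= k)%N ->
        I (fun w => `|s n w - s k w|) <= e].

Definition has_integral f (x : R) :=
  exists2 s, approximates s f & I (s n) @[n --> \oo] --> x.

Context (hG : is_algebra G) (hv : pos_charge G v).

Lemma simple_linear a f g : simple f -> simple g -> simple (fun w => a * f w + g w).
Proof. exact: (simple_map2 hG (fun x y => a * x + y)). Qed.

Lemma simpleB f g : simple f -> simple g -> simple (fun w => f w - g w).
Proof. exact: (simple_map2 hG (fun x y => x - y)). Qed.

Lemma simple_norm f : simple f -> simple (fun w => `|f w|).
Proof. exact: (simple_map hG (fun x => `|x|)). Qed.

Lemma simple_intB f g : simple f -> simple g -> I (fun w => f w - g w) = I f - I g.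
Proof.
move=> sf sg; rewrite [RHS]addrC -mulN1r -(simple_int_linear hG hv) //.
by congr I; apply/funext => w; rewrite mulN1r addrC.
Qed.

Lemma simple_int_norm f : simple f -> `|I f| <= I (fun w => `|f w|).
Proof.
move=> sf; have sn := simple_norm sf; rewrite ler_norml; apply/andP; split.
  rewrite -subr_ge0 opprK addrC -[I (fun _ => _)]mul1r -(simple_int_linear hG hv) //.
  apply: (simple_int_ge0 hG hv); first exact: simple_linear.
  by move=> w; rewrite mul1r -lerBlDr sub0r -normrN ler_norm.
by apply: (simple_int_le hG hv) => // w; exact: ler_norm.
Qed.

Lemma approximates_linear a s t f g : approximates s f -> approximates t g ->
  approximates (fun n w => a * s n w + t n w) (fun w => a * f w + g w).
Proof.
move=> [ss sf sC] [ts tg tC].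
have a2 : 0 < `|a| + 2 by rewrite ltr_wpDl.
split.
- by move=> n; exact: simple_linear.
- move=> e e0; have d0 : 0 < e / (`|a| + 2) by rewrite divr_gt0.
  near=> n; rewrite -(divfK (lt0r_neq0 a2) e) mulrC.
  apply: close_linear => //; first exact: ltW.
    by near: n; exact: sf.
  by near: n; exact: tg.
- move=> e e0; have d0 : 0 < e / (`|a| + 2) by rewrite divr_gt0.
  have [N1 hN1] := sC _ d0; have [N2 hN2] := tC _ d0.
  exists (maxn N1 N2) => n k; rewrite !geq_max => /andP[n1 n2] /andP[k1 k2].
  have h1 := hN1 _ _ n1 k1; have h2 := hN2 _ _ n2 k2.
  have sD := fun n k => simple_norm (simpleB (ss n) (ss k)).
  have tD := fun n k => simple_norm (simpleB (ts n) (ts k)).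
  apply: (@le_trans _ _ (I (fun w => `|a| * `|s n w - s k w| + `|t n w - t k w|))).
    apply: (simple_int_le hG hv).
    + by apply: simple_norm; apply: simpleB; exact: simple_linear.
    + exact: simple_linear.
    move=> w; rewrite (_ : _ - _ = a * (s n w - s k w) + (t n w - t k w)); last by ring.
    by apply: le_trans (ler_normD _ _) _; rewrite normrM.
  rewrite (simple_int_linear hG hv) //.
  have h3 : (`|a| + 2) * (e / (`|a| + 2)) = e by rewrite mulrC divfK // lt0r_neq0.
  move: d0 h1 h2 h3; set d : R := e / _; set x := I _; set y := I _ => d0 h1 h2 h3.
  have : `|a| * x <= `|a| * d by rewrite ler_wpM2l.
  by lra.
Unshelve. all: by end_near. Qed.

Lemma approximates_norm s f : approximates s f ->
  approximates (fun n w => `|s n w|) (fun w => `|f w|).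
Proof.
move=> [ss sf sC]; split.
- by move=> n; exact: simple_norm.
- by move=> e e0; near=> n; apply: close_norm; near: n; exact: sf.
- move=> e e0; have [N hN] := sC _ e0; exists N => n k Nn Nk.
  apply: le_trans (hN _ _ Nn Nk); apply: (simple_int_le hG hv).
  + by apply: simple_norm; apply: simpleB; exact: simple_norm.
  + by apply: simple_norm; apply: simpleB.
  + by move=> w; exact: ler_dist_dist.
Unshelve. all: by end_near. Qed.

Lemma approximates_cst f : simple f -> approximates (fun=> f) f.
Proof.
move=> ss; split=> // e e0.
  by near=> n; apply: close_refl => //; exact: ltW.
exists 0%N => n k _ _; rewrite (_ : (fun=> _) = fun=> 0); last first.
  by apply/funext => w; rewrite subrr normr0.
by rewrite (simple_int_cst hG hv) mul0r ltW.
Unshelve. all: by end_near. Qed.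

(* Outside the set [`|s n| > d], whose charge is small, [`|s n|] is at most [d];
   on it, [`|s n|] is compared with the bounded function [s N]. *)
Lemma approximates0 s : approximates s (fun=> 0) ->
  I (fun w => `|s n w|) @[n --> \oo] --> (0 : R).
Proof.
move=> [ss s0 sC]; apply/cvgrPdist_le => e e0.
have e3 : 0 < e / 3 by rewrite divr_gt0.
have [N hN] := sC _ e3; have [M hM] := simple_norm_bounded (ss N).
have GT := algebraT hG; have vT : 0 <= v setT by exact: (proj1 hv).
have M0 : 0 <= Num.max M 0 by rewrite le_max lexx orbT.
(* The integral will be at most [max M 0 * d + e / 3 + d * v setT]; this [d] keeps the outer two
   terms below [e / 3] together, and the summand 1 keeps the denominator positive. *)
set d : R := e / 3 / (v setT + Num.max M 0 + 1).
have D0 : 0 < v setT + Num.max M 0 + 1 by rewrite ltr_wpDl // addr_ge0.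
have d0 : 0 < d by rewrite divr_gt0.
have dD : d * (v setT + Num.max M 0 + 1) = e / 3 by rewrite divfK // lt0r_neq0.
near=> n.
have sn := simple_norm (ss n); have snN := simple_norm (simpleB (ss n) (ss N)).
rewrite sub0r normrN ger0_norm; last by apply: (simple_int_ge0 hG hv).
have [F [GF vF sF]] : close d (s n) (fun=> 0) by near: n; exact: s0.
apply: (@le_trans _ _ (I (fun w => Num.max M 0 * \1_F w +
    (1 * `|s n w - s N w| + d)))).
  have s1 : simple (fun w => 1 * `|s n w - s N w| + d).
    by apply: simple_linear => //; exact: simple_cst.
  apply: (simple_int_le hG hv) => // [|w].
    by apply: simple_linear => //; exact: simple_indic.
  rewrite mul1r indicE; have [Fw|nFw] := pselect (F w); last first.
    rewrite memNset // mulr0 add0r; have := sF w nFw; rewrite subr0 => h.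
    by apply: le_trans h _; rewrite lerDr.
  rewrite mem_set // mulr1; have h1 := ler_normB (s n w - s N w) (- s N w).
  rewrite opprK subrK normrN in h1; apply: le_trans h1 _.
  have h2 := hM w; have : M <= Num.max M 0 by rewrite le_max lexx.
  by lra.
have s1 := simple_cst hG d.
rewrite !(simple_int_linear hG hv) //; last 2 first.
  exact: simple_indic.
  exact: simple_linear.
rewrite (simple_int_indic hG hv) // (simple_int_cst hG hv).
have Nn : (N <= n)%N by near: n; exact: nbhs_infty_ge.
have h1 := hN _ _ Nn (leqnn N).
have h2 : Num.max M 0 * v F <= Num.max M 0 * d by rewrite ler_wpM2l.
move: h1; set x := I _ => h1; nra.
Unshelve. all: by end_near. Qed.

End Integral.

(** * The finitely additive integral *)

Section HasIntegral.
Context {R : realType} {Omega : Type} (G : set (set Omega)) (v : set Omega -> R).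
Implicit Types (f g : Omega -> R) (s t : nat -> Omega -> R).
Local Notation I := (simple_int v).
Local Notation simple := (simple G).
Local Notation close := (close G v).
Local Notation approximates := (approximates G v).
Local Notation has_integral := (has_integral G v).
Context (hG : is_algebra G) (hv : pos_charge G v).

Lemma has_integral_linear a f g x y : has_integral f x -> has_integral g y ->
  has_integral (fun w => a * f w + g w) (a * x + y).
Proof.
move=> [s sf sx] [t tg ty]; exists (fun n w => a * s n w + t n w).
  exact: approximates_linear.
have [[ss _ _] [ts _ _]] := (sf, tg).
under eq_fun do rewrite (simple_int_linear hG hv) //.
by apply: cvgD => //; apply: cvgMr.
Qed.

Lemma has_integral0 x : has_integral (fun=> 0) x -> x = 0.
Proof.
move=> [s s0 sx]; have [ss _ _] := s0; have /cvgrPdist_le h := approximates0 hG hv s0.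
suff : I (s n) @[n --> \oo] --> (0 : R) by move=> /cvg_lim <- //; apply/esym/cvg_lim.
apply/cvgrPdist_le => e /h; apply: filterS => n; rewrite !sub0r !normrN.
move=> sn; apply: le_trans (simple_int_norm hG hv (ss n)) _.
exact: le_trans (ler_norm _) sn.
Qed.

Lemma has_integral_unique f x y : has_integral f x -> has_integral f y -> x = y.
Proof.
move=> fx fy; have := has_integral_linear (-1) fy fx.
rewrite (_ : (fun w => _) = fun=> 0); last by apply/funext => w; rewrite mulN1r addNr.
by move=> /has_integral0 /eqP; rewrite mulN1r addrC subr_eq0 => /eqP.
Qed.

Lemma approximates_has_integral s f : approximates s f ->
  exists2 x, has_integral f x & I (s n) @[n --> \oo] --> x.
Proof.
move=> sf; have [ss _ sC] := sf.
suff : cvg (I (s n) @[n --> \oo]).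
  by move=> sx; exists (lim (I (s n) @[n --> \oo])) => //; exists s.
apply/cauchy_cvgP/cauchy_exP => e e0.
have e2 : 0 < e / 2 by rewrite divr_gt0.
have [N hN] := sC _ e2; exists (I (s N)); exists N => // n /= Nn.
rewrite /ball /= -(simple_intB hG hv) //.
apply: le_lt_trans (simple_int_norm hG hv (simpleB hG (ss N) (ss n))) _.
by apply: le_lt_trans (hN _ _ (leqnn N) Nn) _; lra.
Qed.

Lemma has_integral_simple f : simple f -> has_integral f (I f).
Proof.
by move=> sf; exists (fun=> f); [exact: approximates_cst|exact: cvg_cst].
Qed.

Lemma approximates_lim s f x : approximates s f -> has_integral f x ->
  I (s n) @[n --> \oo] --> x.
Proof.
by move=> /approximates_has_integral[y fy sy] fx; rewrite (has_integral_unique fx fy).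
Qed.

(** Simple functions approximating a nonnegative [f] may be negative somewhere; their absolute
    values approximate [|f| = f] and have the same limit of integrals. *)
Lemma has_integral_ge0 f x : has_integral f x -> (forall w, 0 <= f w) -> 0 <= x.
Proof.
move=> fx f0; have [s sf _] := fx; have [ss _ _] := sf.
have := approximates_norm hG hv sf.
rewrite (_ : (fun w => `|f w|) = f); last by apply/funext => w; rewrite ger0_norm.
move=> /approximates_lim /(_ fx) Ix; rewrite -(cvg_lim _ Ix) //.
apply: limr_ge; first by apply/cvg_ex; exists x.
by near=> n; apply: (simple_int_ge0 hG hv) => //; exact: simple_norm.
Unshelve. all: by end_near. Qed.

Definition fa_integrable f := exists x, has_integral f x.

Definition fa_int f : R := xget 0 [set x | has_integral f x].

Local Notation L := fa_integrable.
Local Notation J := fa_int.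

Lemma has_integral_fa_int f : L f -> has_integral f (J f).
Proof. by exact: xgetPex. Qed.

Lemma fa_int_eq f x : has_integral f x -> J f = x.
Proof.
by move=> fx; apply: (has_integral_unique _ fx); apply: has_integral_fa_int; exists x.
Qed.

Lemma fa_integrable_linear a f g : L f -> L g -> L (fun w => a * f w + g w).
Proof. by move=> [x fx] [y gy]; exists (a * x + y); exact: has_integral_linear. Qed.

Lemma fa_int_linear a f g : L f -> L g ->
  J (fun w => a * f w + g w) = a * J f + J g.
Proof.
by move=> Lf Lg; apply/fa_int_eq/has_integral_linear; exact: has_integral_fa_int.
Qed.

Lemma fa_integrable_simple f : simple f -> L f.
Proof. by exists (I f); exact: has_integral_simple. Qed.

Lemma fa_int_simple f : simple f -> J f = I f.
Proof. by move=> sf; apply/fa_int_eq/has_integral_simple. Qed.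

Lemma fa_integrable_cst c : L (fun=> c).
Proof. exact/fa_integrable_simple/simple_cst. Qed.

Lemma fa_integrableD f g : L f -> L g -> L (fun w => f w + g w).
Proof.
move=> Lf Lg; have := fa_integrable_linear 1 Lf Lg.
by under eq_fun do rewrite mul1r.
Qed.

Lemma fa_intD f g : L f -> L g -> J (fun w => f w + g w) = J f + J g.
Proof.
move=> Lf Lg; rewrite -[J f]mul1r -fa_int_linear //.
by congr J; apply/funext => w; rewrite mul1r.
Qed.

Lemma fa_integrableB f g : L f -> L g -> L (fun w => f w - g w).
Proof.
move=> Lf Lg; have := fa_integrable_linear (-1) Lg Lf.
by under eq_fun do rewrite mulN1r addrC.
Qed.

Lemma fa_integrableZ c f : L f -> L (fun w => c * f w).
Proof.
move=> Lf; have := fa_integrable_linear c Lf (fa_integrable_cst 0).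
by under eq_fun do rewrite addr0.
Qed.

Lemma fa_int_ge0 f : L f -> (forall w, 0 <= f w) -> 0 <= J f.
Proof. by move=> /has_integral_fa_int; exact: has_integral_ge0. Qed.

Lemma fa_int_le f g : L f -> L g -> (forall w, f w <= g w) -> J f <= J g.
Proof.
move=> Lf Lg fg; rewrite -subr_ge0 addrC -mulN1r -fa_int_linear //.
apply: fa_int_ge0 => [|w]; first exact: fa_integrable_linear.
by rewrite mulN1r addrC subr_ge0.
Qed.

Lemma fa_integrable_norm f : L f -> L (fun w => `|f w|).
Proof.
move=> [x [s sf _]]; have /approximates_has_integral[y fy _] := approximates_norm hG hv sf.
by exists y.
Qed.

Lemma fa_integrable_max f g : L f -> L g -> L (fun w => Num.max (f w) (g w)).
Proof.
move=> Lf Lg.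
have := fa_integrableZ 2^-1 (fa_integrableD (fa_integrableD Lf Lg)
   (fa_integrable_norm (fa_integrableB Lf Lg))).
suff -> : (fun w => Num.max (f w) (g w)) = fun w => 2^-1 * (f w + g w + `|f w - g w|).
  by [].
apply/funext => w; case: (leP (f w) (g w)) => fg; [rewrite ler0_norm|rewrite gtr0_norm]; lra.
Qed.

(** The level sets of [f] need not lie in [G], so Markov's inequality is applied to a simple
    function close to [f]. Half of [e] pays for this replacement and half for the level set, whence
    [e ^+ 2 / 4]. *)
Lemma fa_integral_markov e f : 0 < e -> L f ->
  J (fun w => `|f w|) < e ^+ 2 / 4 -> close e f (fun=> 0).
Proof.
move=> e0 Lf Je; have [x [s sf _]] := Lf; have [ss sc _] := sf.
have sn := fun n => simple_norm hG (ss n).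
have := approximates_lim (approximates_norm hG hv sf)
  (has_integral_fa_int (fa_integrable_norm Lf)).
move=> /cvgr_lt /(_ _ Je) Ie.
have e2 : 0 < e / 2 by rewrite divr_gt0.
near \oo => n.
have [F [GF vF fF]] : close (e / 2) (s n) f by near: n; exact: sc.
pose E := s n @^-1` [set x | e / 2 < `|x|].
have GE : G E by exact: simple_level.
have vE : v E * (e / 2) <= e ^+ 2 / 4.
  apply: (@le_trans _ _ (I (fun w => `|s n w|))); last by apply/ltW; near: n.
  rewrite mulrC -(simple_int_indic hG hv) // -[_ * _]addr0.
  rewrite -(mul0r (v setT)) -(simple_int_cst hG hv 0) -(simple_int_linear hG hv) //; last 2 first.
  - exact: simple_indic.
  - exact: simple_cst.
  apply: (simple_int_le hG hv) => // [|w].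
    by apply: simple_linear => //; [exact: simple_indic|exact: simple_cst].
  rewrite addr0 indicE; have [Ew|nEw] := pselect (E w).
    by rewrite mem_set // mulr1; exact: ltW.
  by rewrite memNset // mulr0.
have [_ GU _] := hG; exists (F `|` E); split; first exact: GU.
  apply: le_trans (charge_setU_le hG hv GF GE) _.
  have : v E <= e / 2 by rewrite -(ler_pM2r e2); apply: le_trans vE _; rewrite expr2; lra.
  by lra.
move=> w nFE; rewrite subr0.
have /fF fw : ~ F w by move=> Fw; apply: nFE; left.
have /negP : ~ (e / 2 < `|s n w|) by move=> Ew; apply: nFE; right.
rewrite -leNgt => sw; have := ler_distD (s n w) (f w) 0.
by rewrite !subr0 distrC; lra.
Unshelve. all: by end_near. Qed.

(** A late term [s N] of an approximating sequence works: [|s n - s N|] approximates [|f - s N|],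
    and its integrals are small by the Cauchy condition. *)
Lemma fa_int_dense f e : 0 < e -> L f ->
  exists2 t : Omega -> R, simple t & J (fun w => `|f w - t w|) <= e.
Proof.
move=> e0 [x [s sf _]]; have [ss _ sC] := sf.
have [N hN] := sC _ e0; exists (s N) => //.
have sN : approximates (fun n w => -1 * s N w + s n w) (fun w => -1 * s N w + f w).
  by apply: approximates_linear => //; exact: approximates_cst.
have sNn := approximates_norm hG hv sN.
have [y fy sy] := approximates_has_integral sNn.
rewrite (_ : (fun w => `|f w - s N w|) = fun w => `|-1 * s N w + f w|); last first.
  by apply/funext => w; rewrite mulN1r addrC.
rewrite (fa_int_eq fy) -(cvg_lim _ sy) //; apply: limr_le.
  by apply/cvg_ex; exists y.
exists N => // n /= Nn; apply: le_trans (hN _ _ Nn (leqnn N)).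
rewrite le_eqVlt; apply/orP; left; apply/eqP.
by congr I; apply/funext => w; rewrite mulN1r addrC.
Qed.

(** This stands in for completeness: the limit [g] in measure is given beforehand. Each [f n] is
    replaced by a simple [t n] near it in norm, hence near it in measure by Markov's inequality. *)
Lemma fa_integrable_limit (f : nat -> Omega -> R) g :
  (forall n, L (f n)) ->
  (forall e : R, 0 < e -> \forall n \near \oo, close e (f n) g) ->
  (forall e : R, 0 < e -> exists N, forall n k, (N <= n)%N -> (N <= k)%N ->
     J (fun w => `|f n w - f k w|) <= e) ->
  L g.
Proof.
move=> Lf fg fC.
have /choice[t ht] (n : nat) :
    exists t : Omega -> R, simple t /\ J (fun w => `|f n w - t w|) <= n.+1%:R^-1.
  have : (0 : R) < n.+1%:R^-1 by rewrite invr_gt0.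
  by move=> /fa_int_dense /(_ (Lf n))[t st tJ]; exists t.
have st n : simple (t n) by case: (ht n).
have Lt n := fa_integrable_simple (st n).
have small (e : R) : 0 < e -> \forall n \near \oo, J (fun w => `|f n w - t n w|) < e.
  move=> e0; near=> n; apply: le_lt_trans (proj2 (ht n)) _; near: n.
  exact: near_infty_natSinv_lt (PosNum e0).
suff /approximates_has_integral[y gy _] : approximates t g by exists y.
split=> //.
- move=> e e0; near=> n.
  rewrite [e](_ : _ = e / 2 + e / 2); last by lra.
  apply: (@close_trans _ _ _ _ hG hv _ _ _ (f n)); last by near: n; apply: fg; lra.
  have [F [GF vF tF]] : close (e / 2) (fun w => f n w - t n w) (fun=> 0).
    apply: fa_integral_markov; [lra|exact: fa_integrableB|].
    by near: n; apply: small; rewrite divr_gt0 // exprn_gt0 // divr_gt0.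
  by exists F; split => // w /tF; rewrite subr0 distrC.
- move=> e e0; have e3 : 0 < e / 3 by lra.
  have [N1 hN1] := fC _ e3; have [N2 _ hN2] := small _ e3.
  exists (maxn N1 N2) => n k; rewrite !geq_max => /andP[n1 n2] /andP[k1 k2].
  have h1 := hN1 _ _ n1 k1; have h2 := ltW (hN2 _ n2); have h3 := ltW (hN2 _ k2).
  have LB a b : L a -> L b -> L (fun w => `|a w - b w|).
    by move=> La Lb; exact/fa_integrable_norm/fa_integrableB.
  rewrite -fa_int_simple; last exact/simple_norm/simpleB.
  apply: (@le_trans _ _ (J (fun w => (`|f n w - t n w| + `|f n w - f k w|) + `|f k w - t k w|))).
    apply: fa_int_le => [| |w].
    + exact: LB.
    + by apply: fa_integrableD; [apply: fa_integrableD|]; exact: LB.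
    + have h4 := ler_distD (f n w) (t n w) (t k w).
      have h5 := ler_distD (f k w) (f n w) (t k w).
      by rewrite (distrC (t n w) (f n w)) in h4; lra.
  rewrite !fa_intD; [lra|exact: LB..| |exact: LB].
  by apply: fa_integrableD; exact: LB.
Unshelve. all: by end_near. Qed.

End HasIntegral.

(** * Order continuity of positive functionals *)

Section PositiveFunctional.
Context {R : realType} {Omega : Type} (L : set (Omega -> R)).
Context (phi : (Omega -> R) -> R).
Hypothesis L0 : L (fun=> 0).
Hypothesis L_linear : forall a f g, L f -> L g -> L (fun w => a * f w + g w).
Hypothesis phi_lin : linear_on L phi.
Hypothesis phi_pos : positive_on L phi.

Lemma functional0 : phi (fun=> 0) = 0.
Proof.
have := phi_lin 1 L0 L0; rewrite (_ : (fun w => _) = fun=> 0).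
  by move/eqP; rewrite mul1r -subr_eq subrr eq_sym => /eqP.
by apply/funext => w; rewrite mulr0 addr0.
Qed.

Lemma functionalZ a f : L f -> phi (fun w => a * f w) = a * phi f.
Proof.
move=> Lf; have := phi_lin a Lf L0; rewrite functional0 addr0 => <-.
by congr phi; apply/funext => w; rewrite addr0.
Qed.

Lemma functionalD f g : L f -> L g -> phi (fun w => f w + g w) = phi f + phi g.
Proof.
move=> Lf Lg; have := phi_lin 1 Lf Lg; rewrite mul1r => <-.
by congr phi; apply/funext => w; rewrite mul1r.
Qed.

Lemma functional_le f g : L f -> L g -> (forall w, f w <= g w) -> phi f <= phi g.
Proof.
move=> Lf Lg fg; rewrite -subr_ge0 addrC -mulN1r -phi_lin //.
apply: phi_pos => [|w]; first exact: L_linear.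
by rewrite mulN1r addrC subr_ge0.
Qed.

Lemma functional_norm_le f g : L f -> L g -> (forall w, `|f w| <= g w) ->
  `|phi f| <= phi g.
Proof.
move=> Lf Lg fg; rewrite ler_norml -mulN1r -functionalZ //; apply/andP; split.
  apply: functional_le => // [|w]; last first.
    by have := fg w; rewrite mulN1r ler_norml => /andP[].
  have := L_linear (-1) Lg L0; suff -> : (fun w => -1 * g w + 0) = fun w => -1 * g w by [].
  by apply/funext => w; rewrite addr0.
by apply: functional_le => // w; apply: le_trans (ler_norm _) (fg w).
Qed.

End PositiveFunctional.

Section OrderContinuity.
Context {R : realType} {Omega : Type} (G : set (set Omega)) (v : set Omega -> R).
Context (phi : (Omega -> R) -> R).
Context (hG : is_algebra G) (hv : pos_charge G v).
Local Notation L := (fa_integrable G v).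
Local Notation J := (fa_int G v).
Local Notation close := (close G v).

Hypothesis phi_lin : linear_on L phi.
Hypothesis phi_pos : positive_on L phi.

Let L0 : L (fun=> 0) := fa_integrable_cst hG hv 0.
Let L_linear a f g := @fa_integrable_linear _ _ _ _ hG hv a f g.

Lemma fa_integrable_sum (d : nat -> Omega -> R) K : (forall k, L (d k)) ->
  L (fun w => \sum_(k < K) d k w).
Proof.
move=> Ld; elim: K => [|K IH]; first by under eq_fun do rewrite big_ord0.
by under eq_fun do rewrite big_ord_recr; exact: fa_integrableD.
Qed.

(* [L] is not norm complete, but a series of nonnegative functions with summable
   integrals does belong to [L] when its tails vanish off small sets. *)
Lemma summable_series_le (d : nat -> Omega -> R) :
  (forall k, L (d k)) -> (forall k w, 0 <= d k w) ->
  (forall k, J (d k) <= 2^-1 ^+ k) ->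
  (forall w, exists N, forall k, (N <= k)%N -> d k w = 0) ->
  (forall e : R, 0 < e -> exists N F, [/\ G F, v F <= e &
     forall w, ~ F w -> forall k, (N <= k)%N -> d k w = 0]) ->
  exists2 g, L g & forall K w, \sum_(k < K) d k w <= g w.
Proof.
move=> Ld d0 Jd dfin dsmall.
pose S K w := \sum_(k < K) d k w.
have LS K : L (S K) by exact: fa_integrable_sum.
have SS K w : S K.+1 w = S K w + d K w by rewrite /S big_ord_recr.
have S_le w : {homo S^~ w : m n / (m <= n)%N >-> m <= n}.
  by apply/nondecreasing_seqP => n; rewrite SS lerDl.
have S_eq N w : (forall k, (N <= k)%N -> d k w = 0) ->
    forall K, (N <= K)%N -> S K w = S N w.
  move=> dN; elim=> [|K IH]; first by rewrite leqn0 => /eqP ->.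
  rewrite leq_eqVlt => /orP[/eqP -> //|NK].
  by rewrite SS dN ?addr0 ?IH.
have /choice[N hN] := dfin.
pose g w := S (N w) w; exists g; last first.
  move=> K w; change (S K w <= g w); rewrite /g.
  have [/S_le -> //|/ltnW NK] := leqP K (N w).
  by rewrite (S_eq _ _ (hN w) _ NK).
apply: (@fa_integrable_limit _ _ _ _ hG hv S g) => //.
  move=> e e0; have [M [F [GF vF dF]]] := dsmall _ e0.
  exists M => // n /= Mn; exists F; split => // w /dF dw.
  rewrite (S_eq _ _ dw _ Mn) /g -(S_eq _ _ dw _ (leq_maxl M (N w))).
  by rewrite (S_eq _ _ (hN w) _ (leq_maxr M (N w))) subrr normr0 ltW.
(* One more summand raises [J (S K)] by at most [2^-1 ^+ K], exactly what the second term loses; so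
   [b] is nonincreasing, which gives the Cauchy estimate. *)
pose b K := J (S K) + 2 * 2^-1 ^+ K.
have b_le : {homo b : m n / (m <= n)%N >-> n <= m}.
  apply/nonincreasing_seqP => n; rewrite /b.
  rewrite (_ : S n.+1 = fun w => S n w + d n w); last by apply/funext => w; rewrite SS.
  rewrite fa_intD // exprS; have := Jd n; set x := _ ^+ n; lra.
have JS_le : {homo (fun n => J (S n)) : m n / (m <= n)%N >-> m <= n}.
  by move=> m n mn; apply: fa_int_le => // w; exact: S_le.
have JB f f' : L f -> L f' -> J (fun w => f w - f' w) = J f - J f'.
  move=> Lf Lf'; rewrite [RHS]addrC -mulN1r -(fa_int_linear hG hv) //.
  by congr J; apply/funext => w; rewrite mulN1r addrC.
have key m n : (m <= n)%N -> J (fun w => `|S n w - S m w|) <= 2 * 2^-1 ^+ m.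
  move=> mn; rewrite (_ : (fun w => _) = fun w => S n w - S m w); last first.
    by apply/funext => w; rewrite ger0_norm // subr_ge0 S_le.
  rewrite JB //; have := b_le _ _ mn; rewrite /b.
  have : 0 <= (2^-1 : R) ^+ n by rewrite exprn_ge0.
  by lra.
move=> e e0; have : 2 * (2^-1 : R) ^+ n @[n --> \oo] --> 2 * (0 : R).
  by apply: cvgMr; apply: cvg_expr; rewrite ger0_norm //; lra.
rewrite mulr0 => /cvgr_lt /(_ _ e0)[M _ hM].
exists M => n k Mn Mk; have [nk|/ltnW kn] := leqP n k.
  rewrite (_ : (fun w => _) = fun w => `|S k w - S n w|); last by apply/funext => w; rewrite distrC.
  by apply: le_trans (key _ _ nk) _; exact/ltW/hM.
by apply: le_trans (key _ _ kn) _; exact/ltW/hM.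
Qed.

Lemma decreasing_functional_cvg0 (c : nat -> Omega -> R) :
  (forall n, L (c n)) -> (forall n w, 0 <= c n w) ->
  (forall n w, c n.+1 w <= c n w) ->
  J (c n) @[n --> \oo] --> (0 : R) ->
  (forall w, exists n, c n w = 0) ->
  (forall e : R, 0 < e -> exists n F, [/\ G F, v F <= e &
     forall w, ~ F w -> c n w = 0]) ->
  phi (c n) @[n --> \oo] --> (0 : R).
Proof.
move=> Lc c0 cS Jc cfin csmall.
have c_le w : {homo c^~ w : m n / (m <= n)%N >-> n <= m}.
  by apply/nonincreasing_seqP => n.
have c_eq0 N w k : c N w = 0 -> (N <= k)%N -> c k w = 0.
  by move=> cN /(c_le w) /= ck; apply/eqP; rewrite eq_le c0 andbT -cN.
(* The condition [k <= n k] lets the subsequence inherit eventual vanishing, at points and off small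
   sets. *)
have /choice[n hn] k : exists n, (k <= n)%N /\ J (c n) <= 2^-1 ^+ k.
  have h : 0 < (2^-1 : R) ^+ k by rewrite exprn_gt0.
  have [M _ hM] : \forall n \near \oo, J (c n) < 2^-1 ^+ k by exact: cvgr_lt Jc _ h.
  by exists (maxn k M); split; [exact: leq_maxl|exact/ltW/hM/leq_maxr].
have kn k : (k <= n k)%N by case: (hn k).
have [|||||g Lg hg] := @summable_series_le (fun k => c (n k)) => //.
- by move=> k; case: (hn k).
- move=> w; have [N cN] := cfin w; exists N => k Nk.
  exact: c_eq0 cN (leq_trans Nk (kn k)).
- move=> e /csmall[N [F [GF vF cF]]]; exists N, F; split => // w /cF cN k Nk.
  exact: c_eq0 cN (leq_trans Nk (kn k)).
have phig : 0 <= phi g.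
  apply: phi_pos => // w; apply: le_trans (hg 0%N w).
  by rewrite big_ord0.
apply/cvgrPdist_le => e e0.
pose K := (Num.truncn (phi g / e)).+1.
have hK : phi g < e * K%:R.
  by rewrite mulrC -ltr_pdivrMr //; exact: truncnS_gt.
exists (\max_(k < K) n k)%N => // m /= hm.
have cm : 0 <= phi (c m) by exact: phi_pos.
rewrite sub0r normrN ger0_norm //.
suff : K%:R * phi (c m) <= phi g.
  have K0 : (0 : R) < K%:R by rewrite ltr0n.
  by move=> h; rewrite -(ler_pM2l K0); apply: le_trans h _; rewrite mulrC ltW.
rewrite -(functionalZ L0 phi_lin) //.
apply: (functional_le L_linear phi_lin phi_pos) => // [|w].
  exact: fa_integrableZ.
(* Since [m] is at least each of the first [K] indices, [c m] lies below each of the first [K]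
   summands of [g]. *)
apply: le_trans (hg K w); rewrite mulr_natl -[K in X in X <= _]card_ord -sumr_const.
apply: ler_sum => k _; apply: c_le.
exact: leq_trans (leq_bigmax (F := fun k : 'I_K => n k) k) hm.
Qed.

(** If a simple [t] near [f] in norm is bounded by [M < n], then the tail [(|f| - n)^+] is at most
    [|f - t|]. *)
Lemma fa_int_tail_cvg0 (f : Omega -> R) : L f ->
  J (fun w => Num.max (`|f w| - n%:R) 0) @[n --> \oo] --> (0 : R).
Proof.
move=> Lf; apply/cvgrPdist_le => e e0.
have [t st Jt] := fa_int_dense hG hv e0 Lf.
have [M tM] := simple_norm_bounded st.
have Lt n : L (fun w => Num.max (`|f w| - n%:R) 0).
  apply: fa_integrable_max => //; apply: fa_integrableB => //.
    exact: fa_integrable_norm.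
  exact: fa_integrable_cst.
exists (Num.truncn M).+1 => // n /= Mn.
rewrite sub0r normrN ger0_norm; last first.
  by apply: fa_int_ge0 => // w; rewrite le_max lexx orbT.
apply: le_trans Jt; apply: fa_int_le => // [|w].
  apply: fa_integrable_norm => //; apply: fa_integrableB => //.
  exact: fa_integrable_simple.
rewrite ge_max normr_ge0 andbT.
have h1 : M < n%:R by apply: lt_le_trans (truncnS_gt M) _; rewrite ler_nat.
have h2 := ler_normB (f w - t w) (- t w); rewrite opprK subrK normrN in h2.
by have h3 := tM w; lra.
Qed.

Lemma functional_tail_cvg0 (f : Omega -> R) : L f ->
  phi (fun w => Num.max (`|f w| - n%:R) 0) @[n --> \oo] --> (0 : R).
Proof.
move=> Lf; have Lnf := fa_integrable_norm hG hv Lf.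
apply: decreasing_functional_cvg0.
- move=> n; apply: fa_integrable_max => //; apply: fa_integrableB => //.
  exact: fa_integrable_cst.
- by move=> n w; rewrite le_max lexx orbT.
- move=> n w; rewrite ge_max !le_max lexx !orbT andbT.
  by rewrite lerB // ler_nat.
- exact: fa_int_tail_cvg0.
- move=> w; exists (Num.truncn `|f w|).+1; apply/max_idPr.
  by rewrite subr_le0 ltW // truncnS_gt.
(* Markov's inequality is applied to [f / n], with [n] so large that its norm is below [d ^+ 2 / 4].
   As [d <= 1], off the exceptional set [|f| <= n] and the tail vanishes; as [d <= e], that set is
   small enough. *)
move=> e e0; pose d := Num.min e 1.
have d0 : 0 < d by rewrite lt_min e0 ltr01.
pose n := (Num.truncn (J (fun w => `|f w|) / (d ^+ 2 / 4))).+1.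
have n0 : (0 : R) < n%:R by rewrite ltr0n.
have [F [GF vF fF]] : close d (fun w => n%:R^-1 * f w) (fun=> 0).
  apply: fa_integral_markov => //; first exact: fa_integrableZ.
  rewrite (_ : (fun w => _) = fun w => n%:R^-1 * `|f w|); last first.
    by apply/funext => w; rewrite normrM gtr0_norm // invr_gt0.
  have -> : (fun w => n%:R^-1 * `|f w|) = fun w => n%:R^-1 * `|f w| + 0.
    by apply/funext => w; rewrite addr0.
  rewrite fa_int_linear // (fa_int_simple hG hv (simple_cst hG 0)).
  rewrite (simple_int_cst hG hv) mul0r addr0 mulrC ltr_pdivrMr // mulrC.
  by rewrite -ltr_pdivrMr ?truncnS_gt // divr_gt0 // exprn_gt0.
exists n, F; split => //; first by apply: le_trans vF _; rewrite ge_min lexx.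
move=> w /fF; rewrite subr0 normrM gtr0_norm ?invr_gt0 // mulrC => h.
apply/max_idPr; rewrite subr_le0 -[leRHS]mul1r -ler_pdivrMr //.
by apply: le_trans h _; rewrite ge_min lexx orbT.
Qed.

End OrderContinuity.

(** * Hahn-Banach and positive extension *)

Section HahnBanach.
Context {R : realType}.

Lemma le_inf_scale (S : set R) (a z : R) : S !=set0 -> 0 <= a ->
  (forall s, S s -> z <= a * s) -> z <= a * inf S.
Proof.
move=> S0; rewrite le_eqVlt => /orP[/eqP <-|a0] zS.
  by have [s /zS] := S0; rewrite !mul0r.
rewrite mulrC -ler_pdivrMr //; apply: lb_le_inf => // s /zS.
by rewrite ler_pdivrMr // mulrC.
Qed.

Lemma le_inf_add (S T : set R) (z : R) : S !=set0 -> T !=set0 ->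
  (forall s t, S s -> T t -> z <= s + t) -> z <= inf S + inf T.
Proof.
move=> S0 T0 zST; rewrite -lerBlDr; apply: lb_le_inf => // s Ss.
rewrite lerBlDr addrC -lerBlDr; apply: lb_le_inf => // t Tt.
by rewrite lerBlDr addrC; exact: zST.
Qed.

Context {V : lmodType R} (D : set V).
Hypothesis D0 : D 0.
Hypothesis D_linear : forall a x y, D x -> D y -> D (a *: x + y).

(** Homogeneity is stated as an inequality because that form passes directly to infima; [sublinearZ]
    recovers equality. *)
Definition sublinear_on (p : V -> R) :=
  (forall x y, D x -> D y -> p (x + y) <= p x + p y) /\
  (forall a x, 0 <= a -> D x -> p (a *: x) <= a * p x).

Let DZ a x : D x -> D (a *: x).
Proof. by move=> Dx; rewrite -[_ *: _]addr0; exact: D_linear. Qed.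

Let DD x y : D x -> D y -> D (x + y).
Proof. by move=> Dx Dy; rewrite -[x]scale1r; exact: D_linear. Qed.

Let DN x : D x -> D (- x).
Proof. by move=> Dx; rewrite -scaleN1r; exact: DZ. Qed.

Lemma sublinear_ge0 p : sublinear_on p -> 0 <= p 0.
Proof. by move=> [pD _]; have := pD _ _ D0 D0; rewrite addr0; lra. Qed.

Lemma sublinear_oppr p x : sublinear_on p -> D x -> - p (- x) <= p x.
Proof.
move=> sp Dx; have := (proj1 sp) _ _ Dx (DN Dx); rewrite subrr.
by have := sublinear_ge0 sp; lra.
Qed.

Lemma sublinearZ p a x : sublinear_on p -> 0 <= a -> D x -> p (a *: x) = a * p x.
Proof.
move=> sp; have [_ pZ] := sp.
rewrite le_eqVlt => /orP[/eqP <-|a0] Dx; apply/eqP; rewrite eq_le.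
  have := pZ _ _ (lexx 0) Dx; rewrite mul0r scale0r => ->.
  exact: sublinear_ge0.
rewrite (pZ _ _ (ltW a0)) //=.
have ai : 0 <= a^-1 by rewrite invr_ge0 ltW.
rewrite -ler_pdivlMl //; apply: le_trans (pZ _ _ ai (DZ a Dx)).
by rewrite scalerA mulVf ?scale1r // gt_eqF.
Qed.

(** Directedness provides one [r] below both [p] and [q], so [r (x + y) <= p x + q y]; the bound
    [- p0 (- x)] keeps the infimum finite. *)
Lemma sublinear_inf (A : set (V -> R)) p0 : A !=set0 ->
  (forall p, A p -> sublinear_on p /\ forall x, D x -> p x <= p0 x) ->
  (forall p q, A p -> A q ->
    exists2 r, A r & forall x, D x -> r x <= p x /\ r x <= q x) ->
  sublinear_on (fun x => inf [set p x | p in A]) /\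
  forall p x, A p -> D x -> inf [set p x | p in A] <= p x.
Proof.
move=> [p1 Ap1] Ap Adir.
have A0 x : [set p x | p in A] !=set0 by exists (p1 x); exists p1.
have infA p x : A p -> D x -> inf [set p x | p in A] <= p x.
  move=> App Dx; apply: ge_inf; last by exists p.
  exists (- p0 (- x)) => _ [q Aq <-]; have [sq qp] := Ap _ Aq.
  by apply: le_trans (sublinear_oppr sq Dx); rewrite lerN2; exact/qp/DN.
split => //; split.
  move=> x y Dx Dy; apply: le_inf_add => // _ _ [p App <-] [q Aq <-].
  have [r Ar rpq] := Adir _ _ App Aq.
  apply: le_trans (infA _ _ Ar (DD Dx Dy)) _.
  apply: le_trans ((proj1 (proj1 (Ap _ Ar))) _ _ Dx Dy) _.
  by apply: lerD; [case: (rpq _ Dx)|case: (rpq _ Dy)].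
move=> a x a0 Dx; apply: le_inf_scale => // _ [p App <-].
by apply: le_trans (infA _ _ App (DZ a Dx)) _; exact: (proj2 (proj1 (Ap _ App))).
Qed.

(* Hence a minimal sublinear functional satisfies [t (- x) = - t x], and is linear. *)
Lemma sublinear_descent t x : sublinear_on t -> D x -> exists q,
  [/\ sublinear_on q, forall y, D y -> q y <= t y & q (- x) <= - t x].
Proof.
move=> st Dx; have [tD tZ] := st.
(* Here [- t (- y)] is a lower bound of [S y]; [a = 0] gives [q <= t], and [a = 1] at [- x] gives
   the last inequality. *)
pose S y := [set t (y + a *: x) - a * t x | a in [set a | 0 <= a]].
have S0 y : S y !=set0 by exists (t (y + 0 *: x) - 0 * t x); exists 0 => /=.
have infS y a : D y -> 0 <= a -> inf (S y) <= t (y + a *: x) - a * t x.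
  move=> Dy a0; apply: ge_inf; last by exists a.
  exists (- t (- y)) => _ [b /= b0 <-].
  have := tD _ _ (DN Dy) (DD Dy (DZ b Dx)).
  by rewrite addKr sublinearZ //; lra.
exists (fun y => inf (S y)); split => [|y Dy|]; last 2 first.
- by have := infS y 0 Dy (lexx _); rewrite scale0r mul0r addr0 subr0.
- have := infS (- x) 1 (DN Dx) ler01; rewrite scale1r addNr mul1r => h.
  apply: le_trans h _.
  have := tZ 0 0 (lexx _) D0; rewrite scale0r mul0r; lra.
split.
  move=> y z Dy Dz; apply: le_inf_add => // _ _ [a /= a0 <-] [b /= b0 <-].
  apply: le_trans (infS _ (a + b) (DD Dy Dz) (addr_ge0 a0 b0)) _.
  have := tD _ _ (DD Dy (DZ a Dx)) (DD Dz (DZ b Dx)).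
  by rewrite scalerDl addrACA; lra.
move=> c y c0 Dy; apply: le_inf_scale => // _ [a /= a0 <-].
apply: le_trans (infS _ (c * a) (DZ c Dy) (mulr_ge0 c0 a0)) _.
rewrite -scalerA -scalerDr mulrBr mulrA lerB //.
by apply: tZ => //; exact/DD/DZ.
Qed.

(** Zorn's lemma is applied to the sublinear functionals below [p0] rather than to partial linear
    extensions: a minimal one is odd, by [sublinear_descent], and an odd sublinear functional is
    linear. *)
Lemma sublinear_ge_linear p0 : sublinear_on p0 ->
  exists l : V -> R,
    (forall a x y, D x -> D y -> l (a *: x + y) = a * l x + l y) /\
    forall x, D x -> l x <= p0 x.
Proof.
(* Functionals matter only on [D]; fixing the value 0 elsewhere makes the pointwise order
   antisymmetric, as Zorn's lemma requires. *)
move=> sp0; pose zero_off (p : V -> R) x := if pselect (D x) then p x else 0.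
have zoffE p x : D x -> zero_off p x = p x by rewrite /zero_off; case: pselect.
have zoff_sub p : sublinear_on p -> sublinear_on (zero_off p).
  move=> [pD pZ]; split=> [x y Dx Dy|a x a0 Dx]; rewrite !zoffE //.
  - exact: pD.
  - exact: DD.
  - exact: pZ.
  - exact: DZ.
pose T := {p : V -> R | [/\ sublinear_on p, forall x, D x -> p x <= p0 x &
                            forall x, ~ D x -> p x = 0]}.
have mkT p : sublinear_on p -> (forall x, D x -> p x <= p0 x) ->
    exists t : T, sval t = zero_off p.
  move=> sp pp0; have h : [/\ sublinear_on (zero_off p),
      forall x, D x -> zero_off p x <= p0 x & forall x, ~ D x -> zero_off p x = 0].
    split; [exact: zoff_sub|by move=> x Dx; rewrite zoffE //; exact: pp0|].
    by move=> x nDx; rewrite /zero_off; case: pselect.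
  by exists (exist _ (zero_off p) h : T).
(* The order is reversed: a maximal element for [below] is a minimal sublinear functional. *)
pose below (p q : T) := `[< forall x, sval q x <= sval p x >].
have [|||A Atot|[t [st tp0 t0]] tmin] := @Zorn T below.
- by move=> p; apply/asboolP.
- move=> p q r /asboolP pq /asboolP qr; apply/asboolP => x.
  exact: le_trans (qr x) (pq x).
- move=> [p hp] [q hq] /asboolP /= pq /asboolP /= qp; apply: eq_exist.
  by apply/funext => x; apply/eqP; rewrite eq_le pq qp.
(* The infimum over an empty chain would be a mere default value, so [p0] serves as the bound
   there. *)
- have [A0|/set0P [p1 Ap1]] := eqVneq A set0.
    have [t _] := mkT p0 sp0 (fun x _ => lexx _).
    by exists t => s; rewrite A0.
  pose B := [set sval p | p in A].
  have [|||sq qB] := @sublinear_inf B p0.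
  + by exists (sval p1); exists p1.
  + by move=> _ [[p [sp pp0 ?]] _ <-].
  + move=> _ _ [p Ap <-] [q Aq <-].
    have [/asboolP pq|/asboolP qp] := Atot _ _ Ap Aq.
      by exists (sval q); [exists q|move=> x _; split].
    by exists (sval p); [exists p|move=> x _; split].
  have [|t tE] := mkT _ sq.
    move=> x Dx; have Bp1 : B (sval p1) by exists p1.
    apply: le_trans (qB _ _ Bp1 Dx) _.
    by case: (p1) => p [sp pp0 ?]; exact: pp0.
  exists t => s As; apply/asboolP => x; rewrite tE /zero_off.
  case: pselect => Dx; first by apply: qB => //; exists s.
  by case: (s) => p [? ? p0']; rewrite /= p0'.
have tN x : D x -> t (- x) = - t x.
  move=> Dx; have [q [sq qt qx]] := sublinear_descent st Dx.
  have [|s sE] := mkT q sq.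
    by move=> y Dy; exact: le_trans (qt _ Dy) (tp0 _ Dy).
  have ts : sval s = t.
    suff /tmin -> : below (exist _ t (And3 st tp0 t0)) s by [].
    apply/asboolP => y; rewrite sE /zero_off /=.
    by case: pselect => [Dy|nDy] /=; [exact: qt|rewrite t0].
  apply/eqP; rewrite eq_le; apply/andP; split.
    by rewrite -[in leLHS]ts sE zoffE //; exact: DN.
  by have := sublinear_oppr st Dx; lra.
exists t; split => // a x y Dx Dy; have [tD tZ] := st.
have tDE x' y' : D x' -> D y' -> t (x' + y') = t x' + t y'.
  move=> Dx' Dy'; apply/eqP; rewrite eq_le tD //=.
  have := tD _ _ (DN Dx') (DN Dy'); rewrite -opprD !tN //; first by lra.
  exact: DD.
rewrite tDE //; last exact: DZ.
congr (_ + _); have [a0|a0] := leP 0 a; first by rewrite sublinearZ.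
have na0 : 0 <= - a by rewrite oppr_ge0 ltW.
rewrite -[a]opprK scaleNr tN; last exact: DZ.
by rewrite sublinearZ // !mulNr.
Qed.

End HahnBanach.

Section PositiveExtension.
Context {R : realType} {Omega : Type} (L : set (Omega -> R)).
Context (phi : (Omega -> R) -> R).
Hypothesis L0 : L (fun=> 0).
Hypothesis L_linear : forall a f g, L f -> L g -> L (fun w => a * f w + g w).
Hypothesis phi_lin : linear_on L phi.
Hypothesis phi_pos : positive_on L phi.

(** On this domain the infimum of [phi] over majorants in [L] is finite; when [L] contains the
    constants, every bounded function belongs to it. *)
Definition dominated : set (Omega -> R) :=
  [set f | exists2 g, L g & forall w, `|f w| <= g w].

Let LZ a f : L f -> L (fun w => a * f w).
Proof.
by move=> Lf; have := L_linear a Lf L0; under eq_fun do rewrite addr0.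
Qed.

Let LD f g : L f -> L g -> L (fun w => f w + g w).
Proof.
by move=> Lf Lg; have := L_linear 1 Lf Lg; under eq_fun do rewrite mul1r.
Qed.

Lemma dominated_linear a f g : dominated f -> dominated g ->
  dominated (fun w => a * f w + g w).
Proof.
move=> [f' Lf' ff'] [g' Lg' gg']; exists (fun w => `|a| * f' w + g' w).
  exact: L_linear.
move=> w; apply: le_trans (ler_normD _ _) _; apply: lerD => //.
by rewrite normrM ler_wpM2l.
Qed.

(** The majorant is [p f], the infimum of [phi g] over [g] in [L] above [f]. For [f >= 0] it gives
    [l (- f) <= phi 0 = 0], hence positivity; on [L] it gives [l <= phi], and the same for [- f]
    forces equality. *)
Lemma positive_extension :
  (forall f, L f -> dominated f) ->
  exists l : (Omega -> R) -> R,
    [/\ linear_on dominated l, positive_on dominated l &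
        forall f, L f -> l f = phi f].
Proof.
move=> Ldom.
pose S (f : Omega -> R) := [set phi g | g in [set g | L g /\ forall w, f w <= g w]].
have S0 f : dominated f -> S f !=set0.
  move=> [g Lg fg]; exists (phi g); exists g => //; split => // w.
  exact: le_trans (ler_norm _) (fg w).
have infS f g : dominated f -> L g -> (forall w, f w <= g w) -> inf (S f) <= phi g.
  move=> [h Lh fh] Lg fg; apply: ge_inf; last by exists g.
  exists (phi (fun w => -1 * h w)) => _ [k [Lk fk] <-].
  apply: (functional_le L_linear phi_lin phi_pos) => //; first exact: LZ.
  by move=> w; apply: le_trans (fk w); have := fh w; rewrite mulN1r ler_norml => /andP[].
have D0 := Ldom _ L0.
have [|l [llin lle]] := sublinear_ge_linear (V := Omega -> R) D0 dominated_linear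
  (p0 := fun f => inf (S f)).
  split.
    move=> f g Df Dg; apply: le_inf_add; [exact: S0..|].
    move=> _ _ [f' [Lf' ff'] <-] [g' [Lg' gg'] <-].
    rewrite -(functionalD phi_lin) //; apply: infS => //.
    + have := dominated_linear 1 Df Dg; suff -> : (fun w => 1 * f w + g w) = f + g by [].
      by apply/funext => w; rewrite mul1r.
    + exact: LD.
    + by move=> w; exact: lerD.
  move=> a f a0 Df; apply: le_inf_scale => //; first exact: S0.
  move=> _ [g [Lg fg] <-]; rewrite -(functionalZ L0 phi_lin) //; apply: infS.
  + have := dominated_linear a Df D0.
    suff -> : (fun w => a * f w + 0) = a *: f by [].
    by apply/funext => w; rewrite addr0.
  + exact: LZ.
  + by move=> w; exact: ler_wpM2l.
have l_lin : linear_on dominated l by exact: llin.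
have DZ a f : dominated f -> dominated (fun w => a * f w).
  by move=> Df; have := dominated_linear a Df D0; under eq_fun do rewrite addr0.
have lZ a f : dominated f -> l (fun w => a * f w) = a * l f.
  exact: (functionalZ D0 l_lin).
exists l; split => //.
  move=> f Df f0; rewrite -oppr_le0 -mulN1r -lZ //.
  apply: le_trans (lle _ (DZ _ _ Df)) _.
  rewrite -(functional0 L0 phi_lin); apply: infS => //; first exact: DZ.
  by move=> w; rewrite mulN1r oppr_le0.
have l_le f : L f -> l f <= phi f.
  by move=> Lf; apply: le_trans (lle _ (Ldom _ Lf)) _; apply: infS => //; exact: Ldom.
move=> f Lf; apply/eqP; rewrite eq_le l_le //=.
have := l_le _ (LZ (-1) Lf); rewrite lZ; last exact: Ldom.
by rewrite (functionalZ L0 phi_lin) // !mulN1r lerN2.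
Qed.

End PositiveExtension.

(** * Total variation *)

Section TotalVariation.
Context {R : realType} {Omega : Type} (G : set (set Omega)).
Context (hG : is_algebra G).
Implicit Types (mu v : set Omega -> R).

(** The pieces are split by the sign of [mu]; on each group the sum is, up to sign, the charge of a
    single union, so each contributes at most [M]. *)
Lemma ba_partition_le mu (M : R) n (P : 'I_n -> set Omega) :
  additive_on G mu -> (forall E, G E -> `|mu E| <= M) ->
  (forall i, G (P i)) -> trivIset setT P ->
  \sum_(i < n) `|mu (P i)| <= M + M.
Proof.
move=> muU muM GP tP; rewrite (bigID (fun i => 0 <= mu (P i))) /=.
have tQ Q : trivIset Q P by exact: sub_trivIset tP.
apply: lerD.
  rewrite (eq_bigr (fun i => mu (P i))) => [|i i0]; last by rewrite ger0_norm.
  rewrite -(additive_bigsetU hG muU) ?index_enum_uniq //.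
  by apply: le_trans (ler_norm _) (muM _ _); exact: algebra_bigsetU.
rewrite (eq_bigr (fun i => - mu (P i))) => [|i i0]; last first.
  by rewrite ltr0_norm // ltNge.
rewrite sumrN -(additive_bigsetU hG muU) ?index_enum_uniq //.
by apply: le_trans (ler_norm _) _; rewrite normrN; apply: muM; exact: algebra_bigsetU.
Qed.

Lemma tvar_ge mu E n (P : 'I_n -> set Omega) : ba G mu ->
  (forall i, G (P i) /\ P i `<=` E) -> trivIset setT P ->
  \sum_(i < n) `|mu (P i)| <= tvar G mu E.
Proof.
move=> [muU [M muM]] PE tP; apply: ub_le_sup; last by exists n, P.
exists (M + M) => _ [k [Q [QE tQ ->]]].
by apply: ba_partition_le => // i; case: (QE i).
Qed.

Lemma tvar_le mu E x :
  (forall n (P : 'I_n -> set Omega), (forall i, G (P i) /\ P i `<=` E) ->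
     trivIset setT P -> \sum_(i < n) `|mu (P i)| <= x) ->
  tvar G mu E <= x.
Proof.
move=> H; apply: ge_sup; last by move=> _ [n [P [PE tP ->]]]; exact: H.
by exists 0, 0%N, (fun=> set0); split=> [[]||]//; rewrite ?big_ord0 // => -[].
Qed.

(** For one inequality each piece is cut along [E] and [F]; for the other, a family inside [E] and
    one inside [F] are concatenated. *)
Lemma tvar_pos_charge mu : ba G mu -> pos_charge G (tvar G mu).
Proof.
move=> hmu; have [muU [M muM]] := hmu; have [G0 GU _] := hG.
have t0 E : 0 <= tvar G mu E.
  have := @tvar_ge mu E 0 (fun=> set0) hmu; rewrite big_ord0; apply; first by case.
  by case.
split=> // E F GE GF EF; apply/eqP; rewrite eq_le; apply/andP; split.
  apply: tvar_le => n P PEF tP.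
  have GP i : G (P i) by case: (PEF i).
  have split_le i : `|mu (P i)| <= `|mu (P i `&` E)| + `|mu (P i `&` F)|.
    have -> : P i = (P i `&` E) `|` (P i `&` F).
      by rewrite -setIUr; apply/esym/setIidPl; case: (PEF i).
    rewrite muU; [|exact: algebraI..|by rewrite setIACA EF setI0].
    by rewrite !setIUl -!setIA !setIid -[F `&` E]setIC EF !setI0 setU0 set0U ler_normD.
  apply: le_trans (ler_sum _ (fun i _ => split_le i)) _.
  rewrite big_split /=; apply: lerD; apply: tvar_ge => //.
  - by move=> i; split; [exact: algebraI|exact: subIsetr].
  - exact: trivIset_setIr.
  - by move=> i; split; [exact: algebraI|exact: subIsetr].
  - exact: trivIset_setIr.
rewrite -lerBrDr; apply: tvar_le => n P PE tP; rewrite lerBrDr addrC -lerBrDr.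
apply: tvar_le => k Q QF tQ; rewrite lerBrDr addrC.
pose S (i : 'I_(n + k)) := match fintype.split i with inl a => P a | inr b => Q b end.
have Sl a : S (lshift k a) = P a by rewrite /S (unsplitK (inl a)).
have Sr b : S (rshift n b) = Q b by rewrite /S (unsplitK (inr b)).
have -> : \sum_(i < n) `|mu (P i)| + \sum_(i < k) `|mu (Q i)| =
          \sum_(i < n + k) `|mu (S i)|.
  rewrite big_split_ord /=; congr (_ + _); apply: eq_bigr => i _.
    by rewrite Sl.
  by rewrite Sr.
have PQ a b w : P a w -> Q b w -> False.
  move=> /(proj2 (PE a)) Ew /(proj2 (QF b)) Fw.
  by have : (E `&` F) w by []; rewrite EF.
apply: tvar_ge => //.
  move=> i; case: (split_ordP i) => [a|b] ->; rewrite ?Sl ?Sr.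
    by case: (PE a) => GP PaE; split => // w /PaE; left.
  by case: (QF b) => GQ QbF; split => // w /QbF; right.
move=> i j _ _; case: (split_ordP i) => [a|b] ->; case: (split_ordP j) => [c|d] ->;
  rewrite ?Sl ?Sr.
- by move=> /(tP _ _ I I) ->.
- by move=> [w [/PQ h /h]].
- by move=> [w [Qw /PQ /(_ Qw)]].
- by move=> /(tQ _ _ I I) ->.
Qed.

Lemma pos_charge_ba v : pos_charge G v -> ba G v.
Proof.
move=> hv; have [v0 vU] := hv; split => //; exists (v setT) => E GE.
by rewrite ger0_norm ?v0 //; apply: (charge_subset hG hv) => //; exact: algebraT.
Qed.

Lemma tvar_id v E : pos_charge G v -> G E -> tvar G v E = v E.
Proof.
move=> hv GE; have [v0 vU] := hv; apply/eqP; rewrite eq_le; apply/andP; split.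
  apply: tvar_le => n P PE tP.
  have GP i : G (P i) by case: (PE i).
  rewrite (eq_bigr (fun i => v (P i))) => [|i _]; last by rewrite ger0_norm ?v0.
  rewrite -(additive_bigsetU hG vU) ?index_enum_uniq //; last exact: sub_trivIset tP.
  apply: (charge_subset hG hv) => //; first exact: algebra_bigsetU.
  by elim/big_ind: _ => // [A B AE BE w [/AE|/BE]|i _] //; case: (PE i).
have := @tvar_ge v E 1 (fun=> E) (pos_charge_ba hv).
rewrite big_ord1 ger0_norm ?v0 //; apply=> [i|i j _ _ _]; first by split.
by rewrite !ord1.
Qed.

End TotalVariation.

(** * Agreement with the Dunford-Schwartz definitions *)

Section Determining.
Context {R : realType} {Omega : Type} (G : set (set Omega)) (hG : is_algebra G).
Implicit Types (mu v : set Omega -> R) (f : Omega -> R).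

(** The definition separates the error level [e] from the size [d] of the exceptional set; closeness
    at [Num.min e d] controls both. *)
Lemma cvg_in_measure_close v (s : nat -> Omega -> R) f : pos_charge G v ->
  (forall e : R, 0 < e ->
    outer G v [set w | e < `|s n w - f w|] @[n --> \oo] --> (0 : R)) <->
  (forall e : R, 0 < e -> \forall n \near \oo, close G v e (s n) f).
Proof.
move=> [v0 _].
pose S E := [set v F | F in [set F | G F /\ E `<=` F]].
have S0 E : S E !=set0.
  by exists (v setT), setT => //; split => //; exact: algebraT.
have lbS E : lbound (S E) 0 by move=> _ [F [GF _] <-]; exact: v0.
split=> [h e e0|h e e0].
  have : \forall n \near \oo, outer G v [set w | e < `|s n w - f w|] < e.
    exact: cvgr_lt (h e e0) _ e0.
  apply: filterS => n /(inf_lt (S0 _)).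
  move=> [_ [F [GF EF] <-] vF]; exists F; split => //; first exact: ltW.
  by move=> w nFw; rewrite leNgt; apply/negP => /EF.
apply/cvgrPdist_le => d d0; have ed : 0 < Num.min e d by rewrite lt_min e0.
apply: filterS (h _ ed) => n [F [GF vF sF]].
rewrite sub0r normrN ger0_norm; last first.
  by apply: lb_le_inf; [exact: S0|exact: lbS].
apply: (@le_trans _ _ (v F)); last by apply: le_trans vF _; rewrite ge_min lexx orbT.
apply: ge_inf; first by exists 0; exact: lbS.
exists F => //; split => // w /= ew; apply: contrapT => /sF.
by rewrite le_min leNgt ew.
Qed.

Lemma cvg_double_le (u : nat -> nat -> R) : (forall n k, 0 <= u n k) ->
  u p.1 p.2 @[p --> (\oo, \oo)] --> (0 : R) <->
  (forall e : R, 0 < e -> exists N, forall n k, (N <= n)%N -> (N <= k)%N ->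
     u n k <= e).
Proof.
move=> u0; split=> [/cvgrPdist_le h e /h [[A B] [/= [N1 _ h1] [N2 _ h2]] AB]|h].
  exists (maxn N1 N2) => n k; rewrite !geq_max => /andP[n1 n2] /andP[k1 k2].
  have := AB (n, k) (conj (h1 _ n1) (h2 _ k2)).
  by rewrite /= sub0r normrN ger0_norm.
apply/cvgrPdist_le => e /h[N hN].
exists ([set n | (N <= n)%N], [set n | (N <= n)%N]) => /=.
  by split; exists N.
by move=> [n k] /= [Nn Nk]; rewrite sub0r normrN ger0_norm // hN.
Qed.

Lemma determiningE mu s f : pos_charge G (tvar G mu) ->
  determining G mu s f <-> approximates G (tvar G mu) s f.
Proof.
move=> hv; have I0 : (forall n, simple G (s n)) -> forall n k,
    0 <= simple_int (tvar G mu) (fun w => `|s n w - s k w|).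
  move=> ss n k; apply: (simple_int_ge0 hG hv) => //.
  by apply: (simple_norm hG); exact: simpleB.
split=> -[ss sf sC]; split=> //.
- exact/(cvg_in_measure_close s f hv).
- exact/(cvg_double_le (I0 ss)).
- exact/(cvg_in_measure_close s f hv).
- exact/(cvg_double_le (I0 ss)).
Qed.

(** A positive charge and its total variation agree only on [G], so exchanging them requires that
    integrals see no other values. *)
Lemma simple_int_congr v v' f : (forall E, G E -> v E = v' E) -> simple G f ->
  simple_int v f = simple_int v' f.
Proof. by move=> vv' [_ Gf]; apply: eq_fsbigr => x _; rewrite vv'. Qed.

Lemma approximates_congr v v' s f : (forall E, G E -> v E = v' E) ->
  approximates G v s f -> approximates G v' s f.
Proof.
move=> vv' [ss sf sC]; split=> // e e0.
  apply: filterS (sf _ e0) => n [F [GF vF sF]].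
  by exists F; split => //; rewrite -vv'.
have [N hN] := sC _ e0; exists N => n k Nn Nk.
rewrite -(simple_int_congr vv') ?hN //.
by apply: (simple_norm hG); exact: simpleB.
Qed.

Lemma L_baE mu : pos_charge G (tvar G mu) ->
  L_ba G mu = fa_integrable G (tvar G mu).
Proof.
move=> hv; apply/seteqP; split=> f.
  by move=> [s /(determiningE _ _ hv)] /(approximates_has_integral hG hv)[x fx _]; exists x.
by move=> [x [s /(determiningE _ _ hv) sf _]]; exists s.
Qed.

Lemma is_integralE v f : pos_charge G v ->
  is_integral G v f = has_integral G v f.
Proof.
move=> hv; have tv E : G E -> tvar G v E = v E by exact: tvar_id.
have htv := tvar_pos_charge hG (pos_charge_ba hG hv).
apply/funext => x; apply/propext; split=> -[s sf sx]; exists s => //.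
  by apply: (approximates_congr tv); exact/determiningE.
by apply/determiningE => //; apply: approximates_congr sf => E /tv.
Qed.

Lemma integral_baE v f : pos_charge G v -> integral_ba G v f = fa_int G v f.
Proof. by move=> hv; rewrite /integral_ba is_integralE. Qed.

Lemma L_ba_pos_charge v : pos_charge G v -> L_ba G v = fa_integrable G v.
Proof.
move=> hv; have tv E : G E -> tvar G v E = v E by exact: tvar_id.
have htv := tvar_pos_charge hG (pos_charge_ba hG hv).
rewrite L_baE //; apply/seteqP; split=> f [x [s sf sx]].
  have /(approximates_has_integral hG hv)[y fy _] := approximates_congr tv sf.
  by exists y.
have /(approximates_has_integral hG htv)[y fy _] :
    approximates G (tvar G v) s f by apply: approximates_congr sf => E /tv.
by exists y.
Qed.

End Determining.

(** * Norm-null decreasing sequences *)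

Section NullFunctional.
Context {R : realType} {Omega : Type} (G : set (set Omega)) (v : set Omega -> R).
Context (phi : (Omega -> R) -> R).
Context (hG : is_algebra G) (hv : pos_charge G v).
Local Notation L := (fa_integrable G v).
Local Notation J := (fa_int G v).

Hypothesis phi_lin : linear_on L phi.
Hypothesis phi_pos : positive_on L phi.
Hypothesis phi_null : forall f, L f -> J (fun w => `|f w|) = 0 -> phi f = 0.

Let L0 : L (fun=> 0) := fa_integrable_cst hG hv 0.
Let L_linear a f g := @fa_integrable_linear _ _ _ _ hG hv a f g.

(** The constant sequence 0 approximates [h], which gives both integrability and norm 0. *)
Lemma null_integrable h : (forall e : R, 0 < e -> close G v e (fun=> 0) h) ->
  L h /\ J (fun w => `|h w|) = 0.
Proof.
move=> hnull.
have h0 : approximates G v (fun _ _ => 0) h.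
  split=> [n|e e0|e e0]; first exact: simple_cst.
    by near=> n; exact: hnull.
  exists 0%N => n k _ _; rewrite (_ : (fun=> _) = fun=> 0); last first.
    by apply/funext => w; rewrite subrr normr0.
  by rewrite (simple_int_cst hG hv) mul0r ltW.
have [x hx _] := approximates_has_integral hG hv h0.
split; first by exists x.
have [y hy] := approximates_has_integral hG hv (approximates_norm hG hv h0).
under eq_fun do under eq_fun do rewrite normr0.
rewrite (simple_int_cst hG hv) mul0r => /(cvg_lim (@Rhausdorff R)).
by rewrite lim_cst // => y0; rewrite (fa_int_eq hG hv hy).
Unshelve. all: by end_near. Qed.

(* The infimum [h] of the sequence is a null function, and for each [e > 0] the
   functions [(c n - h - e)^+] vanish eventually at every point. *)
Lemma norm_decreasing_functional_cvg0 (c : nat -> Omega -> R) :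
  (forall n, L (c n)) -> (forall n w, 0 <= c n w) ->
  (forall n w, c n.+1 w <= c n w) ->
  J (c n) @[n --> \oo] --> (0 : R) ->
  phi (c n) @[n --> \oo] --> (0 : R).
Proof.
move=> Lc c0 cS Jc.
have small (e : R) : 0 < e -> exists n F,
    [/\ G F, v F <= e & forall w, ~ F w -> c n w <= e].
  move=> e0; have e4 : 0 < e ^+ 2 / 4 by rewrite divr_gt0 // exprn_gt0.
  have [n _ /(_ n (leqnn n)) Jn] : \forall n \near \oo, J (c n) < e ^+ 2 / 4.
    exact: cvgr_lt Jc _ e4.
  have [F [GF vF cF]] : close G v e (c n) (fun=> 0).
    apply: fa_integral_markov => //.
    by under eq_fun do rewrite ger0_norm //.
  exists n, F; split => // w /cF; rewrite subr0.
  exact: le_trans (ler_norm _).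
pose h w := inf (range (c^~ w)).
have hlb w : has_lbound (range (c^~ w)) by exists 0 => _ [n _ <-].
have hne w : range (c^~ w) !=set0 by exists (c 0%N w), 0%N.
have h0 w : 0 <= h w by apply: lb_le_inf => // _ [n _ <-].
have hc n w : h w <= c n w by apply: ge_inf => //; exists n.
have [|Lh Jh] := @null_integrable h.
  move=> e /small[n [F [GF vF cF]]]; exists F; split => // w /cF cw.
  by rewrite sub0r normrN ger0_norm // (le_trans (hc n w)).
have phih : phi h = 0 by exact: phi_null.
have L1 : L (fun=> 1) by exact: fa_integrable_cst.
have phi1 : 0 <= phi (fun=> 1) by exact: phi_pos.
pose d e n w := Num.max (c n w - h w - e) 0.
have Ld e n : L (d e n).
  apply: fa_integrable_max => //; apply: fa_integrableB => //; last exact: fa_integrable_cst.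
  exact: fa_integrableB.
have d0 e n w : 0 <= d e n w by rewrite le_max lexx orbT.
have dc e n w : 0 < e -> d e n w <= c n w.
  by move=> e0; rewrite ge_max c0 andbT; have := h0 w; lra.
have phid (e : R) : 0 < e -> phi (d e n) @[n --> \oo] --> (0 : R).
  move=> e0; apply: (decreasing_functional_cvg0 hG hv phi_lin phi_pos) => //.
  - by move=> n w; rewrite ge_max !le_max lexx !orbT andbT !lerB.
  - apply: (squeeze_cvgr _ (cvg_cst 0) Jc); near=> n.
    rewrite fa_int_ge0 //=; apply: fa_int_le => // w; exact: dc.
  - move=> w; have [_ [n _ <-] cn] := inf_adherent e0 (conj (hne w) (hlb w)).
    by exists n; apply/max_idPr; rewrite -/(h w) in cn; lra.
  (* The bound [e'] is for the charge of [F], the bound [e] for the values off [F], where the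
     positive part must vanish. *)
  - move=> e' e'0; have m0 : 0 < Num.min e e' by rewrite lt_min e0.
    have [n [F [GF vF cF]]] := small _ m0; exists n, F; split => //.
      by apply: le_trans vF _; rewrite ge_min lexx orbT.
    move=> w /cF; rewrite le_min => /andP[ce _].
    by apply/max_idPr; have := h0 w; lra.
apply/cvgrPdist_lt => e e0.
(* This makes [e1 * phi 1] less than [e / 2]; the summand 1 covers the case [phi 1 = 0]. *)
pose e1 := e / 2 / (phi (fun=> 1) + 1).
have p1 : 0 < phi (fun=> 1) + 1 by rewrite ltr_wpDl.
have e10 : 0 < e1 by rewrite !divr_gt0.
have e1E : e1 * (phi (fun=> 1) + 1) = e / 2 by rewrite divfK // gt_eqF.
have e2 : 0 < e / 2 by rewrite divr_gt0.
have dsmall : \forall n \near \oo, phi (d e1 n) < e / 2 by exact: cvgr_lt (phid _ e10) _ e2.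
apply: filterS dsmall => n dn.
rewrite sub0r normrN ger0_norm; last exact: phi_pos.
have : phi (c n) <= phi (fun w => e1 * 1 + (d e1 n w + h w)).
  apply: (functional_le L_linear phi_lin phi_pos) => // [|w].
    by apply: L_linear => //; exact: fa_integrableD.
  by have : c n w - h w - e1 <= d e1 n w; [rewrite le_max lexx|lra].
rewrite phi_lin //; last exact: fa_integrableD.
rewrite (functionalD phi_lin) // phih; nra.
Unshelve. all: by end_near. Qed.

End NullFunctional.

(** * Representation by a charge on all subsets *)

Section Representation.
Context {R : realType} {Omega : Type} (L : set (Omega -> R)).
Context (psi : (Omega -> R) -> R).
Hypothesis L_cst : forall c, L (fun=> c).
Hypothesis L_linear : forall a f g, L f -> L g -> L (fun w => a * f w + g w).
Hypothesis L_max : forall f g, L f -> L g -> L (fun w => Num.max (f w) (g w)).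
Hypothesis psi_lin : linear_on L psi.
Hypothesis psi_pos : positive_on L psi.
Hypothesis psi_tail : forall f, L f ->
  psi (fun w => Num.max (`|f w| - n%:R) 0) @[n --> \oo] --> (0 : R).

Let algT : is_algebra [set: set Omega].
Proof. by split. Qed.

Let simpleT (f : Omega -> R) : simple [set: set Omega] f = finite_set (range f).
Proof. by apply/propext; split => [[]|]. Qed.

Let L_norm f : L f -> L (fun w => `|f w|).
Proof.
move=> Lf; suff -> : (fun w => `|f w|) = fun w => Num.max (f w) (-1 * f w + 0).
  by apply: L_max => //; apply: L_linear => //; exact: L_cst.
apply/funext => w; case: (leP (f w) (-1 * f w + 0)) => h.
  by rewrite ler0_norm; lra.
by rewrite gtr0_norm; lra.
Qed.

(** With [N = n + 1], clipping [f] to [[-N, N]] costs the tail and rounding down to a multiple of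
    [1 / N] costs at most [1 / N]. The shift by [N] makes the rounded number nonnegative, so that
    [Num.truncn] is its floor. *)
Let truncation_spec (f : Omega -> R) : exists s : nat -> Omega -> R,
  (forall n, finite_set (range (s n))) /\
  forall n w, `|s n w - f w| <= n.+1%:R^-1 + Num.max (`|f w| - n.+1%:R) 0.
Proof.
pose c n w : R := Num.max (- n.+1%:R) (Num.min (f w) n.+1%:R).
pose k n w := Num.truncn (n.+1%:R * (c n w + n.+1%:R)).
have N0 n : (0 : R) < n.+1%:R by rewrite ltr0n.
have kP n w : (k n w)%:R <= n.+1%:R * (c n w + n.+1%:R) < (k n w).+1%:R.
  by apply: truncn_itv; rewrite mulr_ge0 // -lerBlDr sub0r le_max lexx.
exists (fun n w => (k n w)%:R / n.+1%:R - n.+1%:R); split=> [n|n w].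
  have h : finite_set ((fun j : nat => j%:R / n.+1%:R - n.+1%:R : R) @`
      `I_(n.+1 * (n.+1 + n.+1)).+1) by exact: finite_image.
  apply: sub_finite_set h => _ [w _ <-]; exists (k n w) => //=.
  rewrite ltnS -(ler_nat R); have /andP[+ _] := kP n w => /le_trans; apply.
  rewrite natrM natrD ler_wpM2l // lerD2r ge_max ge_min lexx orbT andbT.
  by rewrite (@le_trans _ _ 0) // oppr_le0.
have /andP[k1 k2] := kP n w.
have h1 : (k n w)%:R / n.+1%:R - n.+1%:R <= c n w.
  by rewrite lerBlDr ler_pdivrMr // mulrC.
have h2 : c n w < (k n w)%:R / n.+1%:R - n.+1%:R + n.+1%:R^-1.
  have -> : (k n w)%:R / n.+1%:R - n.+1%:R + n.+1%:R^-1 =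
      (k n w).+1%:R / n.+1%:R - n.+1%:R :> R.
    by rewrite addrAC -[(k n w).+1%:R]natr1 mulrDl mul1r.
  by rewrite ltrBrDr ltr_pdivlMr // mulrC.
have h3 : `|c n w - f w| <= Num.max (`|f w| - n.+1%:R) 0.
  rewrite le_max /c; have := N0 n; move: n.+1%:R (f w) => N x N_gt0.
  have [xN|Nx] := leP x N.
    have [Nx|xN'] := leP (- N) x; first by rewrite subrr normr0 lexx orbT.
    apply/orP; left; rewrite (@ltr0_norm _ x); last by lra.
    by rewrite ger0_norm; lra.
  apply/orP; left; rewrite max_r; last by lra.
  by rewrite (@gtr0_norm _ x) ?ler0_norm; lra.
move: h1 h2; set N := _^-1; set x := _ / _ - _ => h1 h2.
have := ler_distD (c n w) x (f w).
have : `|x - c n w| <= N by rewrite ler_norml; lra.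
by lra.
Qed.

Lemma positive_functional_representation : exists m : set Omega -> R,
  pos_charge [set: set Omega] m /\
  forall f, L f -> has_integral [set: set Omega] m f (psi f).
Proof.
have Ldom f : L f -> dominated L f by move=> Lf; exists (fun w => `|f w|) => //; exact: L_norm.
have [l [l_lin l_pos lE]] :=
  positive_extension (L_cst 0) L_linear psi_lin psi_pos Ldom.
have D0 := Ldom _ (L_cst 0).
have D_linear := dominated_linear L_linear.
have Dbounded f M : (forall w, `|f w| <= M) -> dominated L f.
  by exists (fun=> M) => //; exact: L_cst.
have Dind (E : set Omega) : dominated L (\1_E).
  apply: (Dbounded _ 1) => w; rewrite indicE.
  by case: (_ \in _); rewrite ?normr1 ?normr0.
pose m (E : set Omega) := l (\1_E).
have m_charge : pos_charge [set: set Omega] m.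
  split=> [E _|E F _ _ EF].
    by apply: l_pos => // w; rewrite indicE; case: (_ \in _).
  rewrite /m -(functionalD l_lin) //; congr l; apply/funext => w; rewrite !indicE.
  have [Ew|nEw] := pselect (E w).
    have nFw : ~ F w by move=> Fw; have : (E `&` F) w by []; rewrite EF.
    by rewrite (mem_set Ew) (memNset nFw) addr0 mem_set //; left.
  rewrite (memNset nEw) add0r; have [Fw|nFw] := pselect (F w).
    by rewrite (mem_set Fw) mem_set //; right.
  by rewrite (memNset nFw) memNset //; case.
have Dsimple s : finite_set (range s) -> dominated L s.
  by rewrite -simpleT => /simple_norm_bounded[M sM]; exact: Dbounded sM.
have lsimple s : finite_set (range s) -> simple_int m s = l s.
  move=> sfin; rewrite /simple_int fsbig_finite //.
  set r := fset_set (range s).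
  (* An arbitrary list of values permits induction through linearity of [l]; for the full list of
     values of [s] the sum of multiples of indicators is [s] itself. *)
  have hr : forall r' : seq R, let g := fun w => \sum_(x <- r') x * \1_(s @^-1` [set x]) w in
      dominated L g /\ l g = \sum_(x <- r') x * m (s @^-1` [set x]).
    elim=> [|x r' [Dg lg]] /=.
      rewrite big_nil (_ : (fun=> _) = fun=> 0); last by apply/funext => w; rewrite big_nil.
      by rewrite (functional0 D0 l_lin).
    rewrite (_ : (fun=> _) = fun w => x * \1_(s @^-1` [set x]) w +
        \sum_(y <- r') y * \1_(s @^-1` [set y]) w); last by apply/funext => w; rewrite big_cons.
    by rewrite big_cons l_lin // lg; split => //; exact: D_linear.
  have [_ <-] := hr r; congr l; apply/funext => w.
  rewrite (bigD1_seq (s w)) ?fset_uniq //=; last first.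
    by rewrite in_fset_set // inE; exists w.
  rewrite big1 ?addr0 => [|x xs]; first by rewrite indicE mem_set // mulr1.
  by rewrite indicE memNset ?mulr0 // => /= sx; move: xs; rewrite sx eqxx.
exists m; split => // f Lf.
have [s [sfin sf]] := truncation_spec f.
(* The functions [s n] are only dominated by [L], but their error bound [g n] lies in [L], where [l]
   equals [psi] and the tail estimate applies. *)
pose g n w : R := n.+1%:R^-1 * 1 + Num.max (`|f w| - n.+1%:R) 0.
have Ltail n : L (fun w => Num.max (`|f w| - n%:R) 0).
  apply: L_max; last exact: L_cst.
  have := L_linear 1 (L_norm Lf) (L_cst (- n%:R)).
  by under eq_fun do rewrite mul1r.
have Lg n : L (g n) by apply: L_linear => //; exact: L_cst.
have psig : psi (g n) @[n --> \oo] --> (0 : R).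
  have -> : (fun n => psi (g n)) = fun n => n.+1%:R^-1 * psi (fun=> 1) +
      psi (fun w => Num.max (`|f w| - n.+1%:R) 0).
    by apply/funext => n; rewrite psi_lin //; exact: L_cst.
  rewrite [X in _ --> X](_ : _ = 0 * psi (fun=> 1) + 0); last by rewrite mul0r addr0.
  apply: cvgD; first by apply: cvgMl; exact: cvg_harmonic.
  by have := psi_tail Lf; rewrite -(cvg_shiftS (fun n => psi (fun w => Num.max (`|f w| - n%:R) 0))).
have Dnorm h : dominated L h -> dominated L (fun w => `|h w|).
  by move=> [h' Lh' hh']; exists h' => // w; rewrite normr_id.
exists s; last first.
  apply/cvgrPdist_le => e e0.
  have small : \forall n \near \oo, psi (g n) < e by exact: cvgr_lt psig _ e0.
  apply: filterS small => n /ltW; apply: le_trans.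
  rewrite distrC lsimple // -lE // -mulN1r addrC -l_lin //; [|exact: Ldom|exact: Dsimple].
  rewrite -lE //; apply: (functional_norm_le D0 D_linear l_lin l_pos); try exact: Ldom.
    by apply: D_linear; [exact: Ldom|exact: Dsimple].
  by move=> w; rewrite mulN1r addrC /g mulr1.
split=> [n|e e0|e e0]; first by rewrite simpleT.
  (* A Chebyshev bound for [m] on the set where the tail is positive; off it only the rounding error
     remains. *)
  pose F n := [set w | n.+1%:R < `|f w|].
  have mF n : n.+1%:R * m (F n) <= psi (fun w => `|f w|).
    rewrite -lE; last exact: L_norm.
    rewrite -(functionalZ D0 l_lin) //; apply: (functional_le D_linear l_lin l_pos).
    - have := D_linear n.+1%:R _ _ (Dind (F n)) D0.
      by under eq_fun do rewrite addr0.
    - exact/Dnorm/Ldom.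
    - move=> w; rewrite indicE; have [Fw|nFw] := pselect (F n w).
        by rewrite mem_set // mulr1 ltW.
      by rewrite memNset // mulr0.
  (* The summand 1 lets one quantity bound both [m (F n)] and the rounding error [n.+1%:R^-1]. *)
  have small : \forall n \near \oo, n.+1%:R^-1 * (psi (fun w => `|f w|) + 1) < e.
    apply: cvgr_lt e0; rewrite -[0](mul0r (psi (fun w => `|f w|) + 1)).
    by apply: cvgMl; exact: cvg_harmonic.
  apply: filterS small => n hn.
  have N0 : (0 : R) < n.+1%:R by rewrite ltr0n.
  have Ni0 : (0 : R) < n.+1%:R^-1 by rewrite invr_gt0.
  have psif : 0 <= psi (fun w => `|f w|) by apply: psi_pos => //; exact: L_norm.
  exists (F n); split => //.
    apply: le_trans (ltW hn); rewrite mulrC ler_pdivlMr // mulrC.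
    by apply: le_trans (mF n) _; rewrite lerDl.
  move=> w /negP; rewrite -leNgt => fw; apply: le_trans (sf n w) _.
  rewrite (max_idPr _) ?subr_le0 // addr0; apply: le_trans (ltW hn).
  by rewrite ler_pMr // lerDr.
have e2 : 0 < e / 2 by rewrite divr_gt0.
have [N _ hN] : \forall n \near \oo, psi (g n) < e / 2 by exact: cvgr_lt psig _ e2.
exists N => n k /hN gn /hN gk.
have sD : finite_set (range (fun w => `|s n w - s k w|)).
  rewrite -simpleT; apply: (simple_norm algT); apply: simpleB => //;
  by rewrite simpleT.
rewrite lsimple //.
apply: (@le_trans _ _ (psi (g n) + psi (g k))); last by lra.
rewrite -(functionalD psi_lin) // -lE; last first.
  have := L_linear 1 (Lg n) (Lg k).
  by under eq_fun do rewrite mul1r.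
apply: (functional_le D_linear l_lin l_pos); first exact: Dsimple.
  apply: Ldom; have := L_linear 1 (Lg n) (Lg k).
  by under eq_fun do rewrite mul1r.
move=> w; have := sf n w; have := sf k w; have := ler_distD (f w) (s n w) (s k w).
by rewrite /g !mulr1 (distrC (f w)) => h1 h2 h3; apply: le_trans h1 _; exact: lerD.
Qed.

End Representation.

(** * Normalisation of the functional and transfer of the order limit *)

Theorem theorem2 (R : realType) (Omega : Type) (A : set (set Omega))
    (mu : set Omega -> R) (phi : (Omega -> R) -> R)
    (hA : is_algebra A) (hmu : ba A mu)
    (phi_null : respects_null A mu phi)
    (phi_lin : linear_on (L_ba A mu) phi)
    (phi_pos : positive_on (L_ba A mu) phi) :
  exists m : set Omega -> R,
    positive_representing_measure (L_ba A mu) phi m /\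
    forall h : nat -> Omega -> R,
      (forall n, L_ba A mu (h n)) ->
      order_cvg A mu h (fun=> 0) ->
      integral_ba [set: set Omega] m (h n) @[n --> \oo] --> (0 : R).
Proof.
(* The space [L_ba A mu] and its norm depend on [mu] only through its total variation, a positive
   charge. *)
pose v := tvar A mu; have hv : pos_charge A v := tvar_pos_charge hA hmu.
have LE : L_ba A mu = fa_integrable A v := L_baE hA hv.
have normE f : Lnorm_ba A mu f = fa_int A v (fun w => `|f w|) := integral_baE hA _ hv.
rewrite /respects_null in phi_null; rewrite /order_cvg.
rewrite LE in phi_null phi_lin phi_pos *.
set L := fa_integrable A v in phi_null phi_lin phi_pos *.
have L_cst c : L (fun=> c) := fa_integrable_cst hA hv c.
have L_linear a f g : L f -> L g -> L (fun w => a * f w + g w).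
  exact: fa_integrable_linear.
have L_max f g : L f -> L g -> L (fun w => Num.max (f w) (g w)).
  exact: fa_integrable_max.
have phi0 := functional0 (L_cst 0) phi_lin.
have phi_null0 f : L f -> fa_int A v (fun w => `|f w|) = 0 -> phi f = 0.
  move=> Lf f0; rewrite -phi0; apply: phi_null => //.
  by rewrite normE; under eq_fun do rewrite subr0.
have phi1 : 0 <= phi (fun=> 1) by exact: phi_pos.
have phi_tail f : L f ->
    phi (fun w => Num.max (`|f w| - n%:R) 0) @[n --> \oo] --> (0 : R).
  exact: functional_tail_cvg0.
have phi_zero f : phi (fun=> 1) = 0 -> L f -> phi f = 0.
  move=> phi10 Lf; have Lnf := fa_integrable_norm hA hv Lf.
  apply/eqP; rewrite -normr_eq0 eq_le normr_ge0 andbT.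
  rewrite -(cvg_lim (@Rhausdorff R) (phi_tail _ Lf)); apply: limr_ge.
    by apply/cvg_ex; exists 0; exact: phi_tail.
  apply: nearW => n.
  have Lt : L (fun w => Num.max (`|f w| - n%:R) 0).
    by apply: L_max => //; apply: fa_integrableB => //; exact: L_cst.
  have /esym := phi_lin n%:R _ _ (L_cst 1) Lt; rewrite phi10 mulr0 add0r => ->.
  apply: (functional_norm_le (L_cst 0) L_linear phi_lin phi_pos) => // [|w].
    exact: (L_linear _ _ _ (L_cst 1) Lt).
  by rewrite mulr1 -lerBlDl le_max lexx.
pose psi f := (phi (fun=> 1))^-1 * phi f.
have psi_lin : linear_on L psi.
  by move=> a f g Lf Lg; rewrite /psi phi_lin // mulrDr mulrCA.
have psi_pos : positive_on L psi.
  by move=> f Lf f0; rewrite mulr_ge0 ?invr_ge0 //; exact: phi_pos.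
have psi_tail f : L f ->
    psi (fun w => Num.max (`|f w| - n%:R) 0) @[n --> \oo] --> (0 : R).
  move=> /phi_tail tail0.
  rewrite [X in _ --> X](_ : _ = (phi (fun=> 1))^-1 * 0); last by rewrite mulr0.
  exact: cvgMr.
have [m [hm mpsi]] :=
  positive_functional_representation L_cst L_linear L_max psi_lin psi_pos psi_tail.
have algT : is_algebra [set: set Omega] by split.
have intm f : L f -> integral_ba [set: set Omega] m f = psi f.
  by move=> /mpsi fpsi; rewrite integral_baE // (fa_int_eq algT hm fpsi).
exists m; split; first split; first split.
- exact: pos_charge_ba.
- by rewrite L_ba_pos_charge // => f /mpsi; exists (psi f).
- move=> f Lf; rewrite intm // /psi.
  have [phi10|phi10] := eqVneq (phi (fun=> 1)) 0.
    by rewrite phi10 mul0r phi_zero.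
  by rewrite mulVKf.
- by move=> E; exact: (proj1 hm).
move=> h Lh [_ [c [Lc c0 cS Jc hc]]].
have phic : phi (c n) @[n --> \oo] --> (0 : R).
  apply: (norm_decreasing_functional_cvg0 hA hv) => //.
  move: Jc; under eq_fun do rewrite normE.
  by under eq_fun do under eq_fun do rewrite ger0_norm //.
have phih : phi (h n) @[n --> \oo] --> (0 : R).
  apply/cvgrPdist_le => e e0.
  have small : \forall n \near \oo, phi (c n) < e by exact: cvgr_lt phic _ e0.
  apply: filterS small => n /ltW; apply: le_trans; rewrite sub0r normrN.
  apply: (functional_norm_le (L_cst 0) L_linear phi_lin phi_pos) => // w.
  by have := hc n w; rewrite subr0.
have -> : (fun n => integral_ba [set: set Omega] m (h n)) = fun n => psi (h n).
  by apply/funext => n; rewrite intm.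
rewrite [X in _ --> X](_ : _ = (phi (fun=> 1))^-1 * 0); last by rewrite mulr0.
exact: cvgMr.
Qed.
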